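(* Let $K$ be a field. For every integer $n\geq 1$, let $S_n=K[x_1,\ldots,x_n,y]$ and let $I_n=(x_1y,x_2y,\ldots,x_ny)\subset S_n$. Then $$\lim_{n\to\infty} \frac{\operatorname{hdepth}(S_n/I_n)}{n} = \frac{1}{2}.$$
   Context: Let $S$ be a polynomial ring in finitely many variables over a field $K$, with the standard grading (each variable has degree $1$), and let $M$ be a finitely generated graded $S$-module. The Hilbert depth of $M$, denoted $\operatorname{hdepth}(M)$, is the maximal depth of a finitely generated graded $S$-module $N$ with the same Hilbert series as $M$. The ideal $I_n$ is the edge ideal of the star graph with vertex set $\{x_1,\ldots,x_n,y\}$ and edges $\{x_i,y\}$, $1\leq i\leq n$. *)

(* Defs.v *)
From HB Require Import structures.
From mathcomp Require Import all_boot all_order all_algebra.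
From mathcomp Require Import generic_quotient ring_quotient.
(* multinomials must be loaded before analysis: their notations clash in the
   other order. *)
From mathcomp Require Import mpoly.
From mathcomp Require Import boolp classical_sets.

Set Implicit Arguments.
Unset Strict Implicit.
Unset Printing Implicit Defensive.

Import GRing.Theory.
Local Open Scope ring_scope.
Local Open Scope quotient_scope.

(* 0 if A is empty or unbounded. *)
Definition natmax (A : set nat) : nat :=
  xget 0%N [set d | A d /\ forall e, A e -> (e <= d)%N]%classic.

(* The submodule (a) V and the quotient V / (a) V, for a finite sequence a of
   elements of R and an R-module V.  For V = R^o the submodule is the ideal
   generated by a. *)
Section IdealMul.
Variables (R : comNzRingType) (a : seq R) (V : lmodType R).

Definition idealmul : {pred V} := fun v =>
  `[< exists w : 'I_(size a) -> V, v = \sum_(i < size a) a`_i *: w i >].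

Lemma idealmulP v :
  reflect (exists w : 'I_(size a) -> V, v = \sum_(i < size a) a`_i *: w i)
          (v \in idealmul).
Proof. exact: asboolP. Qed.

Lemma idealmul_zmod_closed : zmod_closed idealmul.
Proof.
split=> [|u v /idealmulP[w ->] /idealmulP[w' ->]]; apply/idealmulP.
  by exists (fun=> 0); rewrite big1 // => i _; rewrite scaler0.
by exists (fun i => w i - w' i); rewrite -sumrB; apply: eq_bigr => i _;
  rewrite scalerBr.
Qed.

HB.instance Definition _ :=
  GRing.isZmodClosed.Build V idealmul idealmul_zmod_closed.

Lemma idealmulZ p v : v \in idealmul -> p *: v \in idealmul.
Proof.
move=> /idealmulP[w ->]; apply/idealmulP; exists (fun i => p *: w i).
by rewrite scaler_sumr; apply: eq_bigr => i _; rewrite !scalerA mulrC.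
Qed.

Definition quotm := Quotient.quot idealmul.
HB.instance Definition _ := GRing.Zmodule.on quotm.
HB.instance Definition _ := EqQuotient.on quotm.

Definition quotm_pi (v : V) : quotm := \pi_quotm v.

Lemma quotm_pi_eq u v : (quotm_pi u == quotm_pi v) = (u - v \in idealmul).
Proof. exact/esym/(Quotient.idealrBE idealmul). Qed.

Lemma quotm_piB u v : quotm_pi (u - v) = quotm_pi u - quotm_pi v.
Proof. exact: (raddfB (\pi_(Quotient.quot idealmul))). Qed.

Lemma quotm_pi0 : quotm_pi 0 = 0.
Proof. by rewrite -(subrr 0) quotm_piB subrr. Qed.

Lemma quotm_pi_eq0 v : quotm_pi v = 0 <-> v \in idealmul.
Proof.
by rewrite -[v in X in _ <-> X]subr0 -quotm_pi_eq quotm_pi0; split=> /eqP.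
Qed.

Lemma quotm_piD u v : quotm_pi (u + v) = quotm_pi u + quotm_pi v.
Proof. exact: (raddfD (\pi_(Quotient.quot idealmul))). Qed.

Lemma quotm_piK (u : quotm) : quotm_pi (repr u) = u.
Proof. exact: reprK. Qed.

Definition quotm_scale (p : R) (u : quotm) : quotm := quotm_pi (p *: repr u).

Lemma quotm_scaleE p v : quotm_scale p (quotm_pi v) = quotm_pi (p *: v).
Proof.
apply/eqP; rewrite quotm_pi_eq -scalerBr; apply: idealmulZ.
by rewrite -quotm_pi_eq quotm_piK.
Qed.

Lemma quotm_scalerA p q u :
  quotm_scale p (quotm_scale q u) = quotm_scale (p * q) u.
Proof. by rewrite -(quotm_piK u) !quotm_scaleE scalerA. Qed.

Lemma quotm_scale1r : left_id 1 quotm_scale.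
Proof. by move=> u; rewrite -(quotm_piK u) !quotm_scaleE scale1r. Qed.

Lemma quotm_scalerDr : right_distributive quotm_scale +%R.
Proof.
move=> p u v; rewrite -(quotm_piK u) -(quotm_piK v).
by rewrite -quotm_piD !quotm_scaleE scalerDr quotm_piD.
Qed.

Lemma quotm_scalerDl u : {morph quotm_scale^~ u : p q / p + q}.
Proof.
by move=> p q; rewrite -(quotm_piK u) !quotm_scaleE scalerDl quotm_piD.
Qed.

HB.instance Definition _ := GRing.Zmodule_isLmodule.Build R quotm
  quotm_scalerA quotm_scale1r quotm_scalerDr quotm_scalerDl.

Lemma quotm_piZ p v : quotm_pi (p *: v) = p *: quotm_pi v.
Proof. by rewrite -quotm_scaleE. Qed.

HB.instance Definition _ := GRing.isZmodMorphism.Build V quotm quotm_pi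
  quotm_piB.
HB.instance Definition _ := GRing.isScalable.Build R V quotm *:%R quotm_pi
  quotm_piZ.

End IdealMul.

Arguments idealmul {R} a V _.
Arguments quotm {R} a V.
Arguments quotm_pi {R a V} v.

Definition regular_seq (R : comNzRingType) (V : lmodType R) (a : seq R) : Prop :=
  (forall i, (i < size a)%N ->
     injective (fun u : quotm (take i a) V => a`_i *: u)) /\
  (exists u : quotm a V, u != 0).

Definition fingen (R : comNzRingType) (V : lmodType R) : Prop :=
  exists s : seq V, forall v, exists c : 'I_(size s) -> R,
    v = \sum_(i < size s) c i *: s`_i.

(* Z-graded modules over K[X_0, ..., X_{n-1}] with the standard grading.
   The case d = 0 of [gm_degZ] makes each component a K-subspace. *)
Record grmod (K : fieldType) (n : nat) := Grmod {
  gm_sort :> lmodType {mpoly K[n]};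
  gm_deg : int -> set gm_sort;
  gm_deg0 : forall i, gm_deg i 0;
  gm_degD : forall i u v, gm_deg i u -> gm_deg i v -> gm_deg i (u + v);
  gm_degZ : forall i d (p : {mpoly K[n]}) v,
    p \is d.-homog -> gm_deg i v -> gm_deg (i + d%:Z) (p *: v);
  gm_span : forall v, exists (s : seq int) (f : int -> gm_sort),
    [/\ uniq s, forall i, gm_deg i (f i) & v = \sum_(i <- s) f i];
  gm_direct : forall (s : seq int) (f : int -> gm_sort),
    uniq s -> (forall i, gm_deg i (f i)) -> \sum_(i <- s) f i = 0 ->
    {in s, forall i, f i = 0}
}.

Section Hdepth.
Variables (K : fieldType) (n : nat).
Local Notation S := {mpoly K[n]}.

Definition has_kdim (V : lmodType S) (A : set V) (d : nat) : Prop :=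
  exists b : 'I_d -> V, (forall i, A (b i)) /\
    (forall v, A v ->
       exists! c : 'rV[K]_d, v = \sum_(i < d) (c 0 i)%:MP *: b i).

(* 0 if A is infinite-dimensional; the components of a finitely generated
   graded module are finite-dimensional. *)
Definition kdim (V : lmodType S) (A : set V) : nat :=
  xget 0%N [set d | has_kdim A d]%classic.

(* The coefficients of the Hilbert series. *)
Definition hilbert (M : grmod K n) (i : int) : nat := kdim (@gm_deg K n M i).

Definition maxideal : {pred S^o} := idealmul [seq 'X_i | i : 'I_n] S^o.

(* The grade of the graded maximal ideal on V: the members of the sequence are
   not required to be homogeneous.  For V = 0 there is no regular sequence, as
   V / (a) V must be nonzero, and the value is 0 rather than infinity. *)
Definition depth (V : lmodType S) : nat :=
  natmax [set d | exists a : seq S,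
    [/\ {subset a <= maxideal}, regular_seq V a & size a = d]]%classic.

Definition hdepth (M : grmod K n) : nat :=
  natmax [set d | exists N : grmod K n,
    [/\ fingen N, hilbert N =1 hilbert M & depth N = d]]%classic.

End Hdepth.

Section GradedQuotient.
Variables (K : fieldType) (n : nat) (a : seq {mpoly K[n]}).
Local Notation S := {mpoly K[n]}.
Local Notation Q := (quotm a S^o).
Local Notation pi := (@quotm_pi _ a S^o).

Definition homogz (i : int) (p : S) : Prop :=
  if i is Posz d then p \is d.-homog else p = 0.

Definition quot_deg (i : int) : set Q :=
  [set u | exists2 p : S, homogz i p & u = pi p]%classic.

Lemma quot_deg0 i : quot_deg i 0.
Proof. by exists 0; [case: i => // d; apply: dhomog0 | rewrite quotm_pi0]. Qed.

Lemma quot_degD i u v : quot_deg i u -> quot_deg i v -> quot_deg i (u + v).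
Proof.
move=> [p hp ->] [q hq ->]; exists (p + q); last by rewrite quotm_piD.
by case: i hp hq => [d|d] /= hp hq; [apply: rpredD | rewrite hp hq addr0].
Qed.

Lemma quot_degZ i d (p : S) v :
  p \is d.-homog -> quot_deg i v -> quot_deg (i + d%:Z) (p *: v).
Proof.
move=> hp [q hq ->]; exists (p * q); last by rewrite -quotm_piZ.
case: i hq => [e|e] /= hq; last first.
  rewrite hq mulr0; case: (_ + _) => //= k; exact: dhomog0.
by rewrite addnC; apply: dhomogM.
Qed.

Lemma quot_span (v : Q) : exists (s : seq int) (f : int -> Q),
  [/\ uniq s, forall i, quot_deg i (f i) & v = \sum_(i <- s) f i].
Proof.
pose p : S := repr v.
exists [seq Posz d | d <- iota 0 (msize p)].
exists (fun i => if i is Posz d then pi (pihomog mdeg d p) else 0).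
split.
- by rewrite map_inj_uniq ?iota_uniq // => x y [].
- case=> [d|d]; last exact: quot_deg0.
  by exists (pihomog mdeg d p) => //; apply: pihomogP.
rewrite big_map -{1}(quotm_piK v) -/p.
rewrite {1}(@pihomog_partitionE _ _ mdeg (msize p) p) //.
by rewrite -(big_mkord predT (fun i => pihomog mdeg i p))
           /index_iota subn0 -(raddf_sum pi).
Qed.

Hypothesis a_homog : {in a, forall p, p \is homog mdeg}.

Lemma pihomog_mulr d e (c g : S) : g \is e.-homog ->
  exists c', pihomog mdeg d (c * g) = c' * g.
Proof.
move=> hg.
exists (\sum_(k < msize c)
  if (k + e)%N == d then pihomog mdeg k c else 0).
rewrite {1}(@pihomog_partitionE _ _ mdeg (msize c) c) //.
rewrite !mulr_suml linear_sum; apply: eq_bigr => k _ /=.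
have hk : pihomog mdeg k c * g \is (k + e)%N.-homog.
  by apply: dhomogM => //; apply: pihomogP.
case: eqP => [<-|/eqP ne]; first by rewrite pihomog_dE.
by rewrite mul0r (pihomog_ne0 ne).
Qed.

Lemma pihomog_ideal d (p : S) :
  p \in idealmul a S^o -> pihomog mdeg d p \in idealmul a S^o.
Proof.
move=> /idealmulP[w ->].
have /choice[w' hw'] : forall i : 'I_(size a), exists c',
    pihomog mdeg d (w i * a`_i) = c' * a`_i.
  move=> i; have /homogP[e he] := a_homog (mem_nth 0 (ltn_ord i)).
  exact: pihomog_mulr he.
apply/idealmulP; exists w'; rewrite linear_sum; apply: eq_bigr => i _ /=.
by rewrite [a`_i *: w i]mulrC hw' [RHS]mulrC.
Qed.

Lemma quot_direct (s : seq int) (f : int -> Q) :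
  uniq s -> (forall i, quot_deg i (f i)) -> \sum_(i <- s) f i = 0 ->
  {in s, forall i, f i = 0}.
Proof.
move=> us hf; have /choice[p hp] : forall i, exists p : S,
    homogz i p /\ f i = pi p.
  by move=> i; have [p h1 h2] := hf i; exists p.
have -> : \sum_(i <- s) f i = pi (\sum_(i <- s) p i).
  by rewrite (raddf_sum pi); apply: eq_bigr => i _; case: (hp i).
move=> /quotm_pi_eq0 sum_in i si.
have [+ ->] := hp i; case: i si => [d|d] si /= hpi; last first.
  by rewrite hpi quotm_pi0.
apply/quotm_pi_eq0; have := pihomog_ideal d sum_in.
rewrite linear_sum (bigD1_seq _ si us) /= pihomog_dE // big1 ?addr0 // => j.
case: j (hp j) => [e|e] [/= hpj _]; last by rewrite hpj raddf0.
by move=> ne; rewrite (@pihomog_ne0 _ _ _ e).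
Qed.

(* S / (a) with the grading induced from S, for a homogeneous. *)
Definition grquot : grmod K n :=
  Grmod quot_deg0 quot_degD quot_degZ quot_span quot_direct.

End GradedQuotient.

Section Star.
Variables (K : fieldType) (n : nat).

(* In {mpoly K[n.+1]}, x_{i+1} is 'X_(lift ord_max i) (of index i < n) and y is
   the last variable 'X_ord_max. *)
Definition star_gens : seq {mpoly K[n.+1]} :=
  [seq 'X_(lift ord_max i) * 'X_ord_max | i : 'I_n].

Lemma star_gens_homog :
  {in star_gens, forall p, p \is homog mdeg}.
Proof.
move=> _ /mapP[i _ ->]; apply: (@homogE _ _ _ (1 + 1)%N).
by apply: dhomogM; rewrite dhomogX /= mdeg1.
Qed.

Definition star_quot : grmod K n.+1 := grquot star_gens_homog.

End Star.

(* Main.v *)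
From HB Require Import structures.
Require Import Defs.
From mathcomp Require Import all_boot all_order all_algebra.
From mathcomp Require Import mpoly.
From mathcomp Require Import all_classical all_reals all_analysis.
From mathcomp Require Import fraction generic_quotient.
From mathcomp Require Import ring zify lra.
Import numFieldNormedType.Exports.
Set Implicit Arguments.
Unset Strict Implicit.
Unset Printing Implicit Defensive.
Import Order.TTheory GRing.Theory Num.Theory.
Local Open Scope classical_set_scope.
Local Open Scope ring_scope.

(** Let [H] be the Hilbert function of [S_n/I_n].  The monomials outside [I_n]
    are those in [x_1, ..., x_n] alone and the powers of [y], so that [H] has
    generating series 1/(1-t)^n + t/(1-t) ([hilbert_star]).  Both bounds on the
    Hilbert depth come from the coefficients of (1-t)^r H(t), which are the
    values of the [r]-th iterated difference of [H].

    Upper bound.  If a finitely generated graded module [N] has a regular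
    sequence of length [r] in the maximal ideal, then (1-t)^r H_N(t) has
    nonnegative coefficients ([regular_seq_diff_ge0]).  Over an infinite field
    this is seen by replacing the regular sequence with general linear forms.
    For an arbitrary field and inhomogeneous sequences, the general linear form
    is the form z_0 + z_1 u + ... + z_{m-1} u^{m-1} over [N[u]], where
    the z_a are the variables of the polynomial ring: by McCoy's argument
    it is regular on every quotient of [N[u]] extended from a quotient of [N]
    that has no nonzero vector killed by all z_a ([generic_comb_regular]), hence
    it can be moved in front of a regular sequence in exchange for the last
    member ([generic_comb_exchange]).  After [r] exchanges the sequence consists
    of [r] linear forms over the polynomial ring in [r] parameters.  These are
    homogeneous, and on the component of degree [k] they are matrices over a
    domain; the corank over its fraction field of the submodule that they
    generate is the coefficient of t^k in (1-t)^r H_N(t)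
    ([diff_corank_ge0]).  So that polynomials with coefficients in [N] need no
    theory of their own, [N] is made an ideal of a commutative ring, its
    idealization.

    For the star the coefficient of t^(k+1) with [k] odd is
    C(n-r+k, k+1) - C(r-1, k), which is negative for a suitable [k] as soon as
    [r] exceeds n/2 by a small multiple of [n] ([star_hilb_not_ge0]).

    Lower bound.  For r = n/2 the series (1-t)^r H(t) has nonnegative
    coefficients and coincides with 1/(1-t)^(n-r) in degrees above [r], so it is
    a finite sum of series t^b/(1-t)^e ([star_hilb_decomposition]).  Therefore
    [H] is the Hilbert function of a finite direct sum of shifted polynomial
    rings in at least [r] variables ([block_sum_module]), and the first [r]
    variables form a regular sequence on this sum. *)

(** * Weakly regular sequences and generic linear combinations *)

Section WeakRegularity.
Variable E : comNzRingType.
Implicit Types (U W : set E) (Q : seq E).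

Definition subideal U : Prop :=
  [/\ U 0, forall x y, U x -> U y -> U (x - y) & forall e x, U x -> U (e * x)].

Lemma subidealD U x y : subideal U -> U x -> U y -> U (x + y).
Proof.
by case=> U0 UB _ Ux Uy; rewrite -[y]opprK -[- y]sub0r; do 2!apply: (UB) => //.
Qed.

Lemma subideal_sum U (I : Type) (r : seq I) (P : pred I) (F : I -> E) :
  subideal U -> (forall i, P i -> U (F i)) -> U (\sum_(i <- r | P i) F i).
Proof.
move=> sU UF; apply: (big_ind U) => //; first by case: sU.
by move=> x y; apply: subidealD.
Qed.

Definition adjoin_mul U (q : E) W : set E :=
  [set x | exists2 w, W w & U (x - q * w)].

Lemma adjoin_mul_subideal U q W :
  subideal U -> subideal W -> subideal (adjoin_mul U q W).
Proof.
move=> [U0 UB UM] [W0 WB WM]; split.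
- by exists 0; rewrite // mulr0 subr0.
- move=> x y [w Ww Ux] [w' Ww' Uy]; exists (w - w'); first exact: WB.
  by rewrite mulrBr opprD addrACA -opprD; apply: UB.
- move=> e x [w Ww Ux]; exists (e * w); first exact: WM.
  by rewrite mulrCA -mulrBr; apply: UM.
Qed.

Lemma adjoin_mul_le U q W x : subideal W -> U x -> adjoin_mul U q W x.
Proof. by case=> W0 _ _ Ux; exists 0; rewrite // mulr0 subr0. Qed.

Lemma adjoin_mulC U q q' W :
  adjoin_mul (adjoin_mul U q W) q' W = adjoin_mul (adjoin_mul U q' W) q W.
Proof.
apply/predeqP => x; split=> -[w Ww [w' Ww' Ux]]; exists w' => //;
  by exists w => //; rewrite -addrA [- _ - _]addrC addrA.
Qed.

(** Regularity on the quotient of [W] by [U].  The submodule [U] grows along the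
    sequence in place of quotient modules, so that a whole sequence lives in one
    ring. *)
Fixpoint weakly_regular W U Q : Prop :=
  if Q is q :: Q' then
    (forall v, W v -> U (q * v) -> U v) /\ weakly_regular W (adjoin_mul U q W)
      Q'
  else True.

End WeakRegularity.

Section PolynomialExtension.
Variable E : comNzRingType.
Implicit Types (U W : set E) (Q : seq E).

(** The extension [U[u]] of the submodule [U]. *)
Definition coefs_in U : set {poly E} := [set p | forall i, U p`_i].

Lemma coefs_in_subideal U : subideal U -> subideal (coefs_in U).
Proof.
move=> sU; case: (sU) => U0 UB UM; split.
- by move=> i; rewrite coef0.
- by move=> p q Up Uq i; rewrite coefB; apply: UB.
- by move=> p q Uq i; rewrite coefM; apply: subideal_sum => // j _; apply: UM.
Qed.

Lemma coefs_in_adjoin_mul U q W : subideal U -> subideal W ->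
  coefs_in (adjoin_mul U q W) = adjoin_mul (coefs_in U) q%:P (coefs_in W).
Proof.
move=> [U0 UB UM] [W0 WB WM]; apply/predeqP => p; split; last first.
  case=> w Ww Up i; exists w`_i => //.
  by have := Up i; rewrite coefB coefCM.
move=> Hp; have /choice[w Hw] i : exists w, W w /\ U (p`_i - q * w).
  by have [w] := Hp i; exists w.
exists (\poly_(i < size p) w i) => i; rewrite ?coefB ?coefCM coef_poly;
  case: ltnP => ip //; try by case: (Hw i).
by rewrite nth_default // mulr0 subr0.
Qed.

(** A general member of the span of the [z a].  The powers of one parameter
    suffice to keep the coefficients apart. *)
Definition generic_comb m (z : 'I_m -> E) : {poly E} :=
  \sum_(a < m) (z a)%:P * 'X^a.

Lemma coef_generic_comb m (z : 'I_m -> E) (p : {poly E}) N :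
  (generic_comb z * p)`_N =
  \sum_(a < m) (if (a <= N)%N then z a * p`_(N - a) else 0).
Proof.
rewrite mulr_suml coef_sum; apply: eq_bigr => a _.
rewrite -mulrA coefCM coefXnM ltnNge; by case: leqP; rewrite ?mulr0.
Qed.

(** McCoy's argument, by induction on a degree [n] above which [p] vanishes
    modulo [U].  If the product of [p] with the generic form vanishes, its
    top coefficient shows that [z a * p] has degree below [n] for the largest
    [a]; by induction [z a * p] vanishes, and the next lower [a] becomes the
    top one.  Thus every coefficient of [p] is killed by all [z a]. *)
Lemma generic_comb_regular W U m (z : 'I_m -> E) :
  subideal W -> subideal U ->
  (forall v, W v -> (forall a, U (z a * v)) -> U v) ->
  forall p, coefs_in W p -> coefs_in U (generic_comb z * p) -> coefs_in U p.
Proof.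
move=> sW sU socle p; case: (sU) => U0 UB UM.
have: forall i, (size p <= i)%N -> U p`_i by move=> i /(nth_default 0)->.
move: (size p) => n; elim: n p => [|n IH] p Uhi Wp Ulp; first by move=> i;
  apply: Uhi.
suff Uzp a : coefs_in U ((z a)%:P * p).
  move=> i; apply: socle => // a; have := Uzp a i; by rewrite coefCM.
have [k] := ubnP (m - a); elim: k a => // k IHk a lek.
have Uzpn : U (z a * p`_n).
  have := Ulp (a + n)%N; rewrite coef_generic_comb (bigD1 a) //= leq_addr addKn.
  set S := (X in U (_ + X)) => UzS; rewrite -[_ * _](addrK S).
  apply: (UB) => //; apply: subideal_sum => // b neq_ba.
  case: leqP => // leb; have [ltba|ltab|/val_inj/eqP eqba] := ltngtP b a.
  - by apply: (UM); apply: Uhi; rewrite ltn_subRL ltn_add2r.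
  - have ltk : (m - b < k)%N by have := ltn_ord b; lia.
    by have := IHk b ltk (a + n - b)%N; rewrite coefCM.
  - by rewrite eqba in neq_ba.
apply: IH => [i ni|i|].
- rewrite coefCM; have [<- //|nei] := eqVneq n i.
  by apply: (UM); apply: Uhi; rewrite ltn_neqAle nei.
- by rewrite coefCM; case: sW => _ _; apply.
- by rewrite mulrCA; have [_ _] := coefs_in_subideal sU; apply.
Qed.

Definition lin_comb m (z : 'I_m -> E) (x : E) : Prop :=
  exists c : 'I_m -> E, x = \sum_(a < m) c a * z a.

(** A vector killed by all [z a] is killed by every combination of them, so a
    single regular combination excludes such vectors. *)
Lemma lin_comb_socle W U m (z : 'I_m -> E) x : subideal U -> lin_comb z x ->
  (forall v, W v -> U (x * v) -> U v) ->
  forall v, W v -> (forall a, U (z a * v)) -> U v.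
Proof.
move=> sU [c ->] rx v Wv Uz; apply: rx => //; rewrite mulr_suml.
apply: subideal_sum => // a _; rewrite -mulrA.
by case: sU => _ _; apply.
Qed.

(** The generic form is regular modulo each initial segment of the sequence,
    because the next member is regular there and so no vector is killed by all
    [z a]; the last member [x] is used only for this.  Regularity of the form
    modulo [U + q W] is what allows [q] to stay regular once the form has been
    put before it. *)
Lemma generic_comb_exchange W U m (z : 'I_m -> E) x Q :
  subideal W -> subideal U -> {in rcons Q x, forall q, lin_comb z q} ->
  weakly_regular W U (rcons Q x) ->
  weakly_regular (coefs_in W) (coefs_in U) (generic_comb z :: map polyC Q).
Proof.
move=> sW + + ; set l := generic_comb z.
have first_regular V y : subideal V -> lin_comb z y ->
    (forall v, W v -> V (y * v) -> V v) ->
    forall p, coefs_in W p -> coefs_in V (l * p) -> coefs_in V p.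
  by move=> sV zy ry; apply: generic_comb_regular => //;
    apply: lin_comb_socle ry.
elim: Q U => [|q Q IH] U sU zQ /= [rq rQ].
  by split=> //; apply: (first_regular _ _ _ _ rq) => //; apply: zQ;
    rewrite mem_head.
have rlU p : coefs_in W p -> coefs_in U (l * p) -> coefs_in U p.
  by apply: (first_regular _ _ _ _ rq) => //; apply: zQ; rewrite mem_head.
have sV := adjoin_mul_subideal q sU sW.
have [rl rest] : weakly_regular (coefs_in W) (coefs_in (adjoin_mul U q W))
    (l :: map polyC Q).
  by apply: IH => // y Qy; apply: zQ; rewrite inE Qy orbT.
move: rl rest; rewrite coefs_in_adjoin_mul // => rl;
  rewrite adjoin_mulC => rest.
do 2!split=> //; move=> v Wv [w Ww].
have [W0 WB WM] := coefs_in_subideal sW.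
have [U0 UB UM] := coefs_in_subideal sU.
move=> Uqvlw; have [w' Ww' Uww'] : adjoin_mul (coefs_in U) q%:P (coefs_in W) w.
  apply: (rl w Ww); exists v => //.
  by rewrite -opprB -sub0r; apply: UB.
exists w' => //; have rqP p : coefs_in W p -> coefs_in U (q%:P * p) ->
  coefs_in U p.
  by move=> Wp Up i; apply: rq => //; have := Up i; rewrite coefCM.
apply: rqP; first by apply: WB => //; apply: WM.
have -> : q%:P * (v - l * w') = (q%:P * v - l * w) + l * (w - q%:P * w')
  by ring.
by apply: (subidealD (coefs_in_subideal sU)) => //; apply: UM.
Qed.

Lemma generic_comb_step W U m (z : 'I_m -> E) L x Q :
  subideal W -> subideal U -> {in rcons Q x, forall q, lin_comb z q} ->
  weakly_regular W U (L ++ rcons Q x) ->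
  weakly_regular (coefs_in W) (coefs_in U)
    (map polyC L ++ generic_comb z :: map polyC Q).
Proof.
move=> sW + zQ; elim: L U => [|q L IH] U sU; first exact: generic_comb_exchange.
move=> /= [rq rQ]; split.
  by move=> p Wp Uqp i; apply: rq => //; have := Uqp i; rewrite coefCM.
by rewrite -coefs_in_adjoin_mul //; apply: IH => //; apply: adjoin_mul_subideal.
Qed.

End PolynomialExtension.

(** * Coranks of regular sequences of linear forms *)

Local Notation tofrac := (@FracField.tofrac _).

Lemma fraction_denom (A : idomainType) (x : {fraction A}) :
  exists d n : A, d != 0 /\ tofrac d * x = tofrac n.
Proof.
elim/quotW: x => y; exists (frac y).2, (frac y).1; split.
  exact: denom_ratioP.
unlock FracField.tofrac; rewrite -[LHS]FracField.pi_mul.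
apply/eqmodP; rewrite /= FracField.equivfE /FracField.mulf.
by rewrite !numden_Ratio ?(mul1r, mulr1, oner_eq0, denom_ratioP) // mulrC.
Qed.

Lemma fraction_row_denom (A : idomainType) n (f : 'rV[{fraction A}]_n) :
  exists d v, d != 0 /\ tofrac d *: f = map_mx tofrac v.
Proof.
have /choice[d Hd] i : exists d : A, d != 0 /\ exists n, tofrac d * f 0 i =
  tofrac n.
  by have [d [k [? ?]]] := fraction_denom (f 0 i); exists d; split=> //;
    exists k.
have /choice[v Hv] i : exists n, tofrac (d i) * f 0 i = tofrac n
  by case: (Hd i).
exists (\prod_i d i), (\row_i (v i * \prod_(j | j != i) d j)); split.
  by apply/prodf_neq0 => i _; case: (Hd i).
apply/rowP => i; rewrite !mxE (bigD1 i) //= rmorphM mulrAC Hv.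
by rewrite -rmorphM.
Qed.

Section GradedFrame.
Variables (h : nat -> nat) (m : nat).

Section Frame.
Variables (A : idomainType) (E : comNzRingType) (iota : {rmorphism A -> E}).
Variable beta : forall k, 'I_(h k) -> E.

Definition comb k (v : 'rV[A]_(h k)) : E := \sum_i iota (v 0 i) * beta i.

Lemma combB k (u v : 'rV[A]_(h k)) : comb (u - v) = comb u - comb v.
Proof.
rewrite /comb -sumrB; apply: eq_bigr => i _.
by rewrite !mxE rmorphB mulrBl.
Qed.

Lemma comb0 k : comb (0 : 'rV[A]_(h k)) = 0.
Proof. by rewrite -(subrr 0) combB subrr. Qed.

Lemma combD k (u v : 'rV[A]_(h k)) : comb (u + v) = comb u + comb v.
Proof.
rewrite /comb -big_split; apply: eq_bigr => i _.
by rewrite !mxE rmorphD mulrDl.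
Qed.

Lemma combZ k c (v : 'rV[A]_(h k)) : comb (c *: v) = iota c * comb v.
Proof.
rewrite /comb mulr_sumr; apply: eq_bigr => i _.
by rewrite !mxE rmorphM mulrA.
Qed.

Lemma comb_sum k (I : finType) (F : I -> 'rV[A]_(h k)) :
  comb (\sum_i F i) = \sum_i comb (F i).
Proof. by apply: (big_morph (@comb k)) => [u v|]; rewrite ?combD ?comb0. Qed.

Variables (W : set E) (z : 'I_m -> E).
Variable Z : 'I_m -> forall k, 'M[A]_(h k, h k.+1).

(** [W] is the direct sum of graded components that are free over [A], with
    basis [beta] in degree [k], and [z a] acts from degree [k] to degree [k + 1]
    by the matrix [Z a k].  Rank computations take place on these matrices. *)
Record graded_frame : Prop := GradedFrame {
  frame_sub : subideal W;
  frame_free : forall D (v : forall k, 'rV[A]_(h k)),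
    \sum_(k < D) comb (v k) = 0 -> forall k, (k < D)%N -> v k = 0;
  frame_mem : forall k (v : 'rV[A]_(h k)), W (comb v);
  frame_span : forall w, W w ->
    exists D (v : forall k, 'rV[A]_(h k)), w = \sum_(k < D) comb (v k);
  frame_act : forall a k (i : 'I_(h k)), z a * beta i = comb (row i (Z a k)) }.

Definition form (t : 'I_m -> A) : E := \sum_a iota (t a) * z a.
Definition form_mx (t : 'I_m -> A) k : 'M[A]_(h k, h k.+1) :=
  \sum_a t a *: Z a k.

Hypothesis fr : graded_frame.

Lemma form_comb t k (v : 'rV[A]_(h k)) :
  form t * comb v = comb (v *m form_mx t k).
Proof.
have zcomb a : z a * comb v = comb (v *m Z a k).
  rewrite mulmx_sum_row comb_sum /comb mulr_sumr; apply: eq_bigr => i _.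
  by rewrite mulrCA (frame_act fr) -/(comb _) -combZ.
rewrite /form /form_mx mulmx_sumr comb_sum mulr_suml; apply: eq_bigr => a _.
by rewrite -mulrA zcomb -combZ scalemxAr.
Qed.

Definition single k (v : 'rV[A]_(h k)) j : 'rV[A]_(h j) :=
  if @eqP _ k j is ReflectT e then castmx (erefl, congr1 h e) v else 0.

Lemma sum_single k (v : 'rV[A]_(h k)) D : (k < D)%N ->
  \sum_(j < D) comb (single v j) = comb v.
Proof.
move=> ltkD; rewrite (bigD1 (Ordinal ltkD)) //= big1 ?addr0.
  rewrite /single; case: eqP => [e|]; last by case.
    by rewrite castmx_id.
move=> j /eqP nejk; rewrite /single; case: eqP => [e|_]; last exact: comb0.
by case: nejk; apply: val_inj.
Qed.

Definition graded_sub (U : set E) : Prop :=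
  forall D (v : forall k, 'rV[A]_(h k)),
    U (\sum_(k < D) comb (v k)) -> forall k, (k < D)%N -> U (comb (v k)).

(** The form has degree one, so the component of degree [k] of [U + form t * W]
    only involves the component of degree [k - 1] of [W]. *)
Lemma graded_adjoin U t : graded_sub U ->
  forall D (v : forall k, 'rV[A]_(h k)),
  adjoin_mul U (form t) W (\sum_(k < D) comb (v k)) ->
  forall k, (k < D)%N ->
  match k return 'rV[A]_(h k) -> Prop with
  | 0%N => fun u => U (comb u)
  | k'.+1 => fun u => exists w, U (comb (u - w *m form_mx t k'))
  end (v k).
Proof.
move=> gU D v [x Wx Ux] k ltkD.
have [D' [w xE]] := frame_span fr Wx; subst x.
(* Both sums are padded to a common length, the second one being shifted by the
   degree of the form. *)
pose v' j := if (j < D)%N then v j else 0.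
pose w' j := match j return 'rV[A]_(h j) with 0%N => 0
             | j'.+1 => if (j' < D')%N then w j' *m form_mx t j' else 0 end.
have {}Ux : U (\sum_(j < (D + D').+1) comb (v' j - w' j)).
  suff <- : \sum_(k < D) comb (v k) - form t * \sum_(k < D') comb (w k) =
    \sum_(j < (D + D').+1) comb (v' j - w' j) by [].
  under [RHS]eq_bigr => j _ do rewrite combB.
  rewrite sumrB; congr (_ - _).
    rewrite (big_ord_widen _ (fun j => comb (v j)) (leqW (leq_addr D' D))).
    rewrite big_mkcond; apply: eq_bigr => j _.
    by rewrite /v'; case: ifP => // _; rewrite comb0.
  rewrite big_ord_recl comb0 add0r mulr_sumr.
  rewrite (big_ord_widen _ (fun j => form t * comb (w j)) (leq_addl D D')).
  rewrite big_mkcond; apply: eq_bigr => j _ /=.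
  by case: ifP => _; rewrite ?comb0 // form_comb.
have := gU _ (fun j => v' j - w' j) Ux k (leqW (ltn_addr _ ltkD));
  rewrite /v' ltkD /w'.
case: k {ltkD} => [|k]; first by rewrite subr0.
case: ifP => _; first by exists (w k).
by exists 0; rewrite mul0mx.
Qed.

Lemma single_id k (v : 'rV[A]_(h k)) : single v k = v.
Proof. by rewrite /single; case: eqP => [e|]; [rewrite castmx_id | case]. Qed.

Lemma graded_adjoin1 U t k (v : 'rV[A]_(h k)) : graded_sub U ->
  adjoin_mul U (form t) W (comb v) ->
  match k return 'rV[A]_(h k) -> Prop with
  | 0%N => fun u => U (comb u)
  | k'.+1 => fun u => exists w, U (comb (u - w *m form_mx t k'))
  end v.
Proof.
move=> gU; rewrite -(sum_single v (ltnSn k)) => Uv.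
by have := graded_adjoin gU Uv (ltnSn k); rewrite single_id.
Qed.

Lemma graded_sub_adjoin U t : graded_sub U ->
  graded_sub (adjoin_mul U (form t) W).
Proof.
move=> gU D v Uv k ltkD; have := graded_adjoin gU Uv ltkD.
case: k {ltkD} => [|k]; first by apply: adjoin_mul_le; case: fr.
case=> w Uvw; exists (comb w); first exact: (frame_mem fr).
by rewrite (form_comb t) -combB.
Qed.

Local Notation F := {fraction A}.

(** The [B k] are the components of [U] after extension of scalars to the
    fraction field; a vector over [A] falls into them as soon as a nonzero
    multiple of it lies in [U]. *)
Definition represents (U : set E) (B : forall k, 'M[F]_(h k)) : Prop :=
  forall k (v : 'rV[A]_(h k)),
  (exists d, d != 0 /\ U (comb (d *: v))) <-> (map_mx tofrac v <= B k)%MS.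

Definition adjoin_mx (B : forall k, 'M[F]_(h k)) (t : 'I_m ->
  A) k : 'M[F]_(h k) :=
  if k is k'.+1 then (B k'.+1 + map_mx tofrac (form_mx t k'))%MS else B 0%N.

Lemma represents_adjoin U B t : graded_sub U ->
  represents U B -> represents (adjoin_mul U (form t) W) (adjoin_mx B t).
Proof.
move=> gU repU k v; split.
  case=> d [nzd] /(graded_adjoin1 gU).
  case: k v => [|k] v /= => [Uv|[w Uvw]].
    by apply/repU; exists d.
  have : (map_mx tofrac (d *: v - w *m form_mx t k) <= B k.+1)%MS.
    by apply/repU; exists 1; rewrite oner_neq0 scale1r.
  rewrite map_mxB map_mxZ map_mxM => le1.
  have nzdF : tofrac d != 0 by rewrite tofrac_eq0.
  set wL := map_mx tofrac w *m _ in le1.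
  rewrite -(eqmx_scale _ nzdF) -[X in (X <= _)%MS](subrK wL).
  by rewrite addmx_sub_adds // submxMl.
case: k v => [|k] v /=.
  move=> /repU[d [nzd Ud]]; exists d; split=> //; apply: adjoin_mul_le => //.
  by case: fr.
case/sub_addsmxP=> -[bc x] /= vE.
have [d [w [nzd wE]]] := fraction_row_denom x.
pose b := d *: v - w *m form_mx t k.
have /repU[e [nze Ube]] : (map_mx tofrac b <= B k.+1)%MS.
  rewrite /b map_mxB map_mxZ map_mxM -wE vE scalerDr -scalemxAl.
  by rewrite addrK scalemx_sub // submxMl.
exists (e * d); split; first by rewrite mulf_neq0.
exists (comb (e *: w)); first exact: (frame_mem fr).
by rewrite (form_comb t) -combB -scalerA -scalemxAl -scalerBr.
Qed.

Lemma represents_ker U B t k (f : 'rV[F]_(h k)) : subideal U ->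
  represents U B -> (forall v, W v -> U (form t * v) -> U v) ->
  (f *m map_mx tofrac (form_mx t k) <= B k.+1)%MS = (f <= B k)%MS.
Proof.
move=> [_ _ UM] repU rt; have [d [v [nzd vE]]] := fraction_row_denom f.
have nzdF : tofrac d != 0 by rewrite tofrac_eq0.
rewrite -(eqmx_scale _ nzdF) -[RHS](eqmx_scale _ nzdF) scalemxAl vE -map_mxM.
apply/idP/idP => /repU[e [nze Ue]]; apply/repU; exists e; split=> //.
  by apply: rt; [exact: (frame_mem fr)|rewrite (form_comb t) -scalemxAl].
by rewrite scalemxAl -(form_comb t); apply: UM.
Qed.

(** Multiplication by the form induces a map from the component of degree [k] to
    the quotient of the next one by [B k.+1].  Regularity of the form says that
    the kernel of this map is [B k]. *)
Lemma rank_adjoin_mx U B t k : subideal U ->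
  represents U B -> (forall v, W v -> U (form t * v) -> U v) ->
  (\rank (adjoin_mx B t k.+1) + \rank (B k) = \rank (B k.+1) + h k)%N.
Proof.
move=> sU repU rt /=; set L := map_mx _ _; set C := cokermx (B k.+1).
have kerC : (kermx C :=: B k.+1)%MS.
  apply/eqmxP/andP; split; apply/rV_subP => v.
    by move/sub_kermxP/eqP; rewrite -submxE.
  by rewrite submxE => /eqP/sub_kermxP.
have kerLC : (kermx (L *m C) :=: B k)%MS.
  apply/eqmxP/andP; split; apply/rV_subP => v.
    move/sub_kermxP/eqP; rewrite mulmxA -submxE.
    by rewrite (represents_ker v sU repU rt).
  rewrite -(represents_ker v sU repU rt) submxE -mulmxA => /eqP.
  by move/sub_kermxP.
have rankLC : (\rank (L *m C) + \rank (B k) = h k)%N.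
  by rewrite -kerLC mxrank_ker subnKC // rank_leq_row.
have rankBLC : \rank ((B k.+1 + L)%MS *m C) = \rank (L *m C).
  rewrite (addsmxMr (B k.+1) L C) /C mulmx_coker.
  by rewrite adds0mx.
have := mxrank_mul_ker (B k.+1 + L)%MS C; rewrite rankBLC.
have -> : \rank ((B k.+1 + L)%MS :&: kermx C) = \rank (B k.+1).
  by rewrite (capmx_idPr _) kerC // addsmxSl.
by move: rankLC; lia.
Qed.

End Frame.

Definition backward_diff (f : nat -> int) (k : nat) : int :=
  f k - (if k is k'.+1 then f k' else 0).

Section FrameRank.
Variables (A : idomainType) (E : comNzRingType) (iota : {rmorphism A -> E}).
Variable beta : forall k, 'I_(h k) -> E.
Variables (W : set E) (z : 'I_m -> E).
Variable Z : 'I_m -> forall k, 'M[A]_(h k, h k.+1).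
Hypothesis fr : graded_frame iota beta W z Z.

(** Each regular form replaces the corank function by its backward difference
    ([rank_adjoin_mx]), and coranks are nonnegative. *)
Lemma diff_corank_ge0 (ts : seq ('I_m -> A)) U B : subideal U ->
  graded_sub iota beta U -> represents iota beta U B ->
  weakly_regular W U [seq form iota z t | t <- ts] ->
  forall k, 0 <= iter (size ts) backward_diff (fun k => (h k)%:Z - (\rank (B
    k))%:Z) k.
Proof.
elim: ts U B => [|t ts IH] U B sU gU repU /=.
  by move=> _ k; rewrite subr_ge0 lez_nat rank_leq_row.
move=> [rt rts] k; have sW := frame_sub fr.
have := IH _ _ (adjoin_mul_subideal _ sU sW) (graded_sub_adjoin fr gU)
  (represents_adjoin fr t gU repU) rts k.
rewrite -iterS iterSr; congr (0 <= iter _ _ _ k); apply/funext => -[|j].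
  by rewrite /backward_diff subr0.
have := rank_adjoin_mx fr j sU repU rt; rewrite /backward_diff /=; lia.
Qed.

Lemma diff_rank_ge0 (ts : seq ('I_m -> A)) :
  weakly_regular W [set 0] [seq form iota z t | t <- ts] ->
  forall k, 0 <= iter (size ts) backward_diff (fun k => (h k)%:Z) k.
Proof.
have free1 k (v : 'rV[A]_(h k)) : comb iota beta v = 0 -> v = 0.
  rewrite -(sum_single iota beta v (ltnSn k)) => /(frame_free fr)/(_ k (ltnSn
    k)).
  by rewrite single_id.
have s0 : subideal [set (0 : E)].
  by split=> //= [x y -> ->|e x ->]; rewrite ?subr0 ?mulr0.
move=> /(diff_corank_ge0 (B := fun k => 0) s0) => H k.
have -> : (fun k => (h k)%:Z) = (fun k => (h k)%:Z -
    (\rank (0 : 'M[{fraction A}]_(h k)))%:Z).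
  by apply/funext => j; rewrite mxrank0 subr0.
apply: H => [D v /(frame_free fr) v0 j ltjD|j v /=].
  by rewrite v0 // comb0.
split=> [[d [nzd /free1/rowP dv0]]|].
  suff -> : v = 0 by rewrite map_mx0 sub0mx.
  apply/rowP => i; have /eqP := dv0 i.
  by rewrite !mxE mulf_eq0 (negPf nzd) => /eqP.
rewrite submx0 => /eqP/rowP v0; have -> : v = 0.
  by apply/rowP => i; have /eqP := v0 i; rewrite !mxE tofrac_eq0 => /eqP.
exists 1; split; first exact: oner_neq0.
by rewrite scaler0 comb0.
Qed.

(** Adjoining a parameter changes neither the bases nor the matrices: all
    conditions can be read off coefficientwise. *)
Lemma graded_frame_poly :
  graded_frame (map_poly iota : {rmorphism {poly A} -> {poly E}})
    (fun k i => (beta i)%:P) (coefs_in W) (fun a => (z a)%:P)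
    (fun a k => map_mx polyC (Z a k)).
Proof.
have coef_comb k (v : 'rV[{poly A}]_(h k)) c :
    (comb (map_poly iota) (fun k i => (beta i)%:P) v)`_c =
    comb iota beta (map_mx (coefp c) v).
  rewrite /comb coef_sum; apply: eq_bigr => i _.
  by rewrite coefMC coef_map !mxE.
split.
- exact: coefs_in_subideal (frame_sub fr).
- move=> D v v0 k ltkD; apply/rowP => i; apply/polyP => c.
  have vk0 : map_mx (coefp c) (v k) = 0.
    apply: (frame_free fr (D := D) (v :=
      fun k => map_mx (coefp c) (v k))) => //.
    by under eq_bigr do rewrite -coef_comb; rewrite -coef_sum v0 coef0.
  by have := congr1 (fun M : 'rV_(h k) => M 0 i) vk0; rewrite !mxE coef0.
- by move=> k v c; rewrite coef_comb; apply: (frame_mem fr).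
- move=> w Ww.
  have /choice[Dv Hv] c : exists Dv : nat * (forall k, 'rV[A]_(h k)),
      w`_c = \sum_(k < Dv.1) comb iota beta (Dv.2 k).
    by have [D [v]] := frame_span fr (Ww c); exists (D, v).
  pose D := (\max_(c < size w) (Dv c).1)%N.
  exists D, (fun k => \row_i \poly_(c < size w)
    (if (k < (Dv c).1)%N then (Dv c).2 k 0 i else 0)).
  apply/polyP => c; rewrite coef_sum; under eq_bigr do rewrite coef_comb.
  case: (ltnP c (size w)) => ltc; last first.
    rewrite nth_default // big1 // => k _; rewrite -[RHS](comb0 iota beta k).
    by congr comb; apply/rowP => i; rewrite !mxE /= coef_poly ltnNge ltc.
  have leD : ((Dv c).1 <= D)%N.
    by apply: (leq_bigmax_cond (F := fun c :
      'I_(size w) => (Dv c).1) (Ordinal ltc)).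
  rewrite Hv (big_ord_widen _ (fun k => comb iota beta ((Dv c).2 k)) leD).
  rewrite big_mkcond; apply: eq_bigr => k _.
  case: ifP => ltk; last rewrite -[LHS](comb0 iota beta k);
    by congr comb; apply/rowP => i; rewrite !mxE /= coef_poly ltc ltk.
- move=> a k i; rewrite -polyCM (frame_act fr) /comb rmorph_sum /=.
  by apply: eq_bigr => j _; rewrite !mxE map_polyC /= polyCM.
Qed.

End FrameRank.

(** Induction on the length of [Q]: one parameter is adjoined for each member of
    [Q], and a generic linear form takes its place.  The domain,
      the ring and the
    frame vary during the induction.  For empty [Q] only linear forms are left
    and [diff_rank_ge0] applies. *)
Theorem diff_ge0 (A : idomainType) (E : comNzRingType)
    (iota : {rmorphism A -> E}) (beta : forall k, 'I_(h k) -> E) (W : set E)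
    (z : 'I_m -> E) (Z : 'I_m -> forall k, 'M[A]_(h k, h k.+1))
    (ts : seq ('I_m -> A)) (Q : seq E) :
  graded_frame iota beta W z Z -> {in Q, forall q, lin_comb z q} ->
  weakly_regular W [set 0] ([seq form iota z t | t <- ts] ++ Q) ->
  forall k, 0 <= iter (size ts + size Q) backward_diff (fun k => (h k)%:Z) k.
Proof.
move En : (size Q) => n; elim: n => [|n IH] in A E iota beta W z Z ts Q En *.
  by rewrite (size0nil En) cats0 addn0 => fr _; apply: diff_rank_ge0 fr _.
case/lastP: Q En => [//|Q x]; rewrite size_rcons => -[En] fr zQ reg k.
have s0 : subideal [set (0 : E)].
  by split=> //= [u v -> ->|e u ->]; rewrite ?subr0 ?mulr0.
have := generic_comb_step (frame_sub fr) s0 zQ reg.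
have -> : coefs_in [set (0 : E)] = [set 0].
  apply/predeqP => p; split=> [p0|-> i]; last by rewrite coef0.
  by apply/polyP => i; rewrite coef0 p0.
pose ts' := rcons [seq (fun a => (t a)%:P) | t <- ts] (fun a : 'I_m => 'X^a).
have -> : map polyC [seq form iota z t | t <- ts] ++
      generic_comb z :: map polyC Q =
    [seq form (map_poly iota : {rmorphism {poly A} -> {poly E}})
      (fun a => (z a)%:P) t | t <- ts'] ++ map polyC Q.
  rewrite /ts' map_rcons cat_rcons -!map_comp; congr (_ ++ _ :: _).
    apply: eq_map => t /=; rewrite /form rmorph_sum; apply: eq_bigr => a _.
    by rewrite /= map_polyC polyCM.
  by apply: eq_bigr => a _; rewrite /= map_polyXn mulrC.
move/(IH _ _ _ _ _ _ _ _ _ _ (graded_frame_poly fr)).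
rewrite size_map size_rcons size_map addSnnS; apply=> //.
move=> _ /mapP[q Qq ->]; have [|c ->] := zQ q;
  first by rewrite mem_rcons inE Qq orbT.
exists (fun a => (c a)%:P); rewrite rmorph_sum; apply: eq_bigr => a _.
by rewrite /= polyCM.
Qed.

End GradedFrame.

(** * The Hilbert series of the star *)

(** The number of monomials of degree [d] in [e] variables. *)
Definition multichoose (e d : nat) : nat := 'C((e + d).-1, d).

Lemma multichooseS e d :
  multichoose e.+1 d.+1 = (multichoose e d.+1 + multichoose e.+1 d)%N.
Proof. by rewrite /multichoose !addnS !addSn /= binS. Qed.

Lemma multichoose_n0 e : multichoose e 0 = 1%N.
Proof. by rewrite /multichoose bin0. Qed.

Lemma multichoose_0n d : multichoose 0 d = (d == 0%N).
Proof. by case: d => // d; rewrite /multichoose bin_small. Qed.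

(** The coefficients of t^b/(1-t)^e, for [p = (e, b)]. *)
Definition shifted_hilb (p : nat * nat) (k : nat) : nat :=
  if (p.2 <= k)%N then multichoose p.1 (k - p.2) else 0%N.

Lemma diff_shifted_hilb e b :
  backward_diff (fun k => (shifted_hilb (e.+1, b) k)%:Z) =
  (fun k => (shifted_hilb (e, b) k)%:Z).
Proof.
apply/funext => k; rewrite /backward_diff /shifted_hilb /=.
have [ltbk|ltkb|->] := ltngtP b k.
- case: k ltbk => // k ltbk; rewrite ltnS in ltbk.
  by rewrite ltbk subSn // multichooseS PoszD addrK.
- by case: k ltkb => [|k] ltkb; rewrite ?subr0 // leqNgt (ltnW ltkb) subr0.
- case: k => [|k]; first by rewrite !multichoose_n0.
  by rewrite subnn ltnn !multichoose_n0.
Qed.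

Lemma iter_diff_shifted_hilb r e b :
  iter r backward_diff (fun k => (shifted_hilb ((e + r)%N, b) k)%:Z) =
  (fun k => (shifted_hilb (e, b) k)%:Z).
Proof.
elim: r => [|r IH]; first by rewrite addn0.
by rewrite iterSr addnS diff_shifted_hilb IH.
Qed.

Lemma diff_add f g : backward_diff (fun k => f k + g k) =
  (fun k => backward_diff f k + backward_diff g k).
Proof.
by apply/funext => -[|k]; rewrite /backward_diff ?subr0 // opprD addrACA.
Qed.

Lemma iter_diff_add r f g :
  iter r backward_diff (fun k => f k + g k) =
    (fun k => iter r backward_diff f k + iter r backward_diff g k).
Proof. by elim: r => // r IH; rewrite !iterS IH diff_add. Qed.

Lemma diff_inj : injective backward_diff.
Proof.
move=> f g fg; apply/funext => k; elim: k => [|k IH].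
  by have := congr1 (fun f => f 0%N) fg; rewrite /backward_diff !subr0.
by have := congr1 (fun f => f k.+1) fg; rewrite /backward_diff IH => /addIr.
Qed.

Lemma iter_diff_inj r : injective (iter r backward_diff).
Proof. by elim: r => // r IH f g /= /diff_inj/IH. Qed.

Definition star_hilb (n k : nat) : nat := (multichoose n k + (0 < k))%N.

(** The first difference turns t/(1-t) into t, and the others multiply it by
    (1-t)^r. *)
Lemma iter_diff_gt0 r k : iter r.+1 backward_diff (fun k => (0 < k)%:Z) k =
  if k is k'.+1 then (-1) ^+ k' * ('C(r, k'))%:Z else 0.
Proof.
elim: r k => [|r IH] k.
  by case: k => [|[|k]] //=; rewrite bin0n mulr0.
rewrite iterS; case: k => [|k]; first by rewrite /backward_diff IH subr0.
rewrite {1}/backward_diff !IH; case: k => [|k]; first by rewrite !bin0 subr0.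
rewrite binS PoszD exprS; ring.
Qed.

Lemma iter_diff_star_hilb n r k : (r < n)%N ->
  iter r.+1 backward_diff (fun k => (star_hilb n k)%:Z) k =
  (multichoose (n - r.+1) k)%:Z +
  if k is k'.+1 then (-1) ^+ k' * ('C(r, k'))%:Z else 0.
Proof.
move=> ltrn; rewrite -iter_diff_gt0.
have -> : (fun k => (star_hilb n k)%:Z) =
    (fun k => (shifted_hilb ((n - r.+1 + r.+1)%N, 0%N) k)%:Z + (0 < k)%:Z).
  by apply/funext => j; rewrite subnK // /shifted_hilb /= subn0 -PoszD.
by rewrite iter_diff_add iter_diff_shifted_hilb /shifted_hilb /= subn0.
Qed.

(** Repeated use of t^b/(1-t)^(e+1) = t^b/(1-t)^e + t^(b+1)/(1-t)^(e+1) pushes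
    all shifts up to [d]; the only terms left behind are the t^b with [b < d],
    and these are the ones that truncation removes. *)
Lemma truncated_decomposition e b d : exists l : seq (nat * nat),
  (forall p, p \in l -> (p.1 <= e)%N) /\
  forall k, (\sum_(p <- l) shifted_hilb p k)%N =
    if (d <= k)%N then shifted_hilb (e, b) k else 0%N.
Proof.
have base e' b' : (d <= b')%N -> exists l : seq (nat * nat),
  (forall p, p \in l -> (p.1 <= e')%N) /\
  forall k, (\sum_(p <- l) shifted_hilb p k)%N =
    if (d <= k)%N then shifted_hilb (e', b') k else 0%N.
  move=> ledb; exists [:: (e', b')]; split=> [p|k].
    by rewrite inE => /eqP->.
  rewrite big_seq1; case: leqP => // ltkd; rewrite /shifted_hilb /= leqNgt.
  by rewrite (leq_trans ltkd).
elim: e b => [|e IHe] b.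
  have [/base//|ltbd] := leqP d b; exists [::]; split=> // k; rewrite big_nil.
  case: leqP => // ledk; rewrite /shifted_hilb /= (leq_trans (ltnW ltbd) ledk).
  by rewrite multichoose_0n subn_eq0 leqNgt (leq_trans ltbd ledk).
have [m] := ubnP (d - b); elim: m b => // m IHm b ltm.
have [/base//|ltbd] := leqP d b.
have [l [le lE]] := IHe b.
have [|l' [le' lE']] := IHm b.+1; first by lia.
exists (l ++ l'); split=> [p|k].
  by rewrite mem_cat => /orP[/le/leqW|/le'].
rewrite big_cat /= lE lE'; case: leqP => // ledk; rewrite /shifted_hilb /=.
rewrite (leq_trans (ltnW ltbd) ledk) (leq_trans ltbd ledk).
have -> : (k - b = (k - b.+1).+1)%N by lia.
by rewrite multichooseS.
Qed.

(** With [r] at most n/2, the binomial coefficients of the alternating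
    polynomial t (1-t)^(r-1) are dominated by the coefficients of 1/(1-t)^(n-r).
    So (1-t)^r H(t) is nonnegative, and above degree [r] it is
    1/(1-t)^(n-r).  A finite sum of monomials t^b accounts for the low degrees
    and [truncated_decomposition] for the others; dividing by (1-t)^r raises
    each exponent [e] by [r]. *)
Lemma star_hilb_decomposition n r : (0 < r)%N -> (r.*2 <= n)%N ->
  exists l : seq (nat * nat),
  (forall p, p \in l -> (r <= p.1 <= n)%N) /\
  forall k, (\sum_(p <- l) shifted_hilb p k)%N = star_hilb n k.
Proof.
case: r => // r _ le2rn; have ltrn : (r < n)%N by lia.
set Q := iter r.+1 backward_diff (fun k => (star_hilb n k)%:Z).
have QE k : Q k = _ := iter_diff_star_hilb k ltrn.
have Q_ge0 k : 0 <= Q k.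
  rewrite QE; case: k => [|k]; first by rewrite addr0.
  rewrite -signr_odd; case: (odd k); last by rewrite expr0 mul1r addr_ge0.
  rewrite expr1 mulN1r subr_ge0 lez_nat /multichoose.
  have -> : (n - r.+1 + k.+1).-1 = (n - r.+2 + k).+1 by lia.
  by rewrite binS (leq_trans _ (leq_addl _ _)) // leq_bin2l //; lia.
have [l [le lE]] := truncated_decomposition (n - r.+1) 0 r.+2.
pose l' := l ++ flatten [seq nseq `|Q b| (0%N, b) | b <- iota 0 r.+2].
have l'E k : (\sum_(p <- l') shifted_hilb p k)%:Z = Q k.
  rewrite /l' big_cat lE big_flatten big_map.
  have -> : (\sum_(b <- iota 0 r.+2) \sum_(p <- nseq `|Q b| (0,
    b)) shifted_hilb p k =
      \sum_(b <- iota 0 r.+2) if b == k then `|Q b| else 0)%N.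
    apply: eq_bigr => b _; rewrite big_nseq iter_addn addn0 /shifted_hilb /=.
    rewrite multichoose_0n subn_eq0 eqn_leq.
    by case: (b <= k)%N; case: (k <= b)%N; rewrite ?mul1n ?mul0n.
  have [ltk|gek] := leqP r.+2 k.
    rewrite big_seq big1 ?addn0 => [|b]; last first.
      by rewrite mem_iota => ltb; case: eqP => // eb; exfalso; lia.
    rewrite QE /shifted_hilb /= subn0; case: k ltk => // k ltk.
    by rewrite bin_small ?mulr0 ?addr0 //; lia.
  rewrite (bigD1_seq k) ?iota_uniq ?mem_iota //= eqxx big1 ?addn0.
    by rewrite add0n gez0_abs.
  by move=> b /negPf->.
exists [seq ((p.1 + r.+1)%N, p.2) | p <- l']; split=> [_ /mapP[p pl ->] /=|k].
  rewrite leq_addl /=; suff : (p.1 <= n - r.+1)%N.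
    by rewrite (leq_subRL _ ltrn) addnC.
  move: pl; rewrite mem_cat => /orP[/le//|/flattenP[_ /mapP[b _ ->]]].
  by rewrite mem_nseq => /andP[_ /eqP->].
apply/eqP; rewrite -eqz_nat; apply/eqP; move: k.
pose raise := [seq ((p.1 + r.+1)%N, p.2) | p <- l'].
suff H : (fun k => (\sum_(p <- raise) shifted_hilb p k)%:Z) =
    (fun k => (star_hilb n k)%:Z).
  move=> k; rewrite -/raise.
  by rewrite -[LHS]/((fun k => (\sum_(p <- raise) shifted_hilb p k)%:Z) k) H.
rewrite /raise.
apply: (@iter_diff_inj r.+1); rewrite -/Q.
transitivity (fun k => (\sum_(p <- l') shifted_hilb p k)%:Z); last exact/funext.
elim: (l') => [|[e b] s IH].
  rewrite [X in iter _ _ X](_ : _ = (fun=> 0)); last by apply/funext=> k;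
    rewrite big_nil.
  rewrite [RHS](_ : _ = (fun=> 0)); last by apply/funext=> k; rewrite big_nil.
  elim: r.+1 => // m IHm; rewrite iterS IHm; apply/funext => -[|k];
    by rewrite /backward_diff subrr.
rewrite [X in iter _ _ X](_ : _ =
  (fun k => (shifted_hilb ((e + r.+1)%N, b) k)%:Z +
  (\sum_(p <- [seq ((p.1 + r.+1)%N, p.2) | p <- s]) shifted_hilb p k)%:Z));
    last first.
  by apply/funext => k; rewrite big_cons PoszD.
rewrite iter_diff_add iter_diff_shifted_hilb IH.
by apply/funext => k; rewrite big_cons PoszD.
Qed.

(** The first two terms of Vandermonde's convolution. *)
Lemma bin_vandermonde_le c d j :
  ('C(c, j.+1) + d * 'C(c, j) <= 'C(c + d, j.+1))%N.
Proof.
elim: d => [|d IH]; first by rewrite addn0 mul0n addn0.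
rewrite addnS binS mulSn addnCA addnC leq_add //.
by rewrite leq_bin2l // leq_addr.
Qed.

(** With [r = n - s] and [d = n - 2 s - (k + 1)], the number C(r-1, k) is at
    least C(s+k, k) + d C(s+k, k-1), while C(s+k, k+1) is s/(k+1) times
    C(s+k, k), and C(s+k, k) is (s+1)/k times C(s+k, k-1).  The numerical
    hypothesis makes the former exceed the latter. *)
Lemma star_hilb_not_ge0 n s k : (odd k) -> (n - s.*2 > k.+1)%N ->
  (s * s.+1 < (n - s.*2 - k.+1) * (k * k.+1))%N ->
  iter (n - s) backward_diff (fun k => (star_hilb n k)%:Z) k.+1 < 0.
Proof.
move=> oddk ltkn big; have [r rE] : exists r, (n - s = r.+1)%N.
  by exists (n - s).-1; lia.
rewrite rE iter_diff_star_hilb; last by lia.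
have -> : (n - r.+1 = s)%N by lia.
rewrite -signr_odd oddk expr1 mulN1r subr_lt0 ltz_nat /multichoose.
case: k oddk ltkn big => // k _ ltkn big.
have -> : (s + k.+2).-1 = (s + k.+1)%N by lia.
set d := (n - s.*2 - k.+2)%N in big.
have -> : r = (s + k.+1 + d)%N by rewrite /d; lia.
apply: leq_trans (bin_vandermonde_le _ _ _).
have e1 : (k.+2 * 'C(s + k.+1, k.+2) = s * 'C(s + k.+1, k.+1))%N.
  by rewrite mul_bin_left; congr (_ * _)%N; lia.
have e2 : (k.+1 * 'C(s + k.+1, k.+1) = s.+1 * 'C(s + k.+1, k))%N.
  by rewrite mul_bin_left; congr (_ * _)%N; lia.
have pos : (0 < 'C(s + k.+1, k))%N by rewrite bin_gt0; lia.
move: ('C(s + k.+1, k.+2)) ('C(s + k.+1, k.+1)) ('C(s + k.+1, k)) e1 e2 pos big.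
move=> X Y Zz e1 e2 pos big.
nia.
Qed.

(** * Modules as ideals of their idealization *)

Section Idealmul.
Variables (R : comNzRingType) (V : lmodType R).

Lemma idealmul_nil v : (v \in idealmul [::] V) = (v == 0).
Proof.
apply/idealmulP/eqP => [[w ->]|->]; first by rewrite big_ord0.
by exists (fun=> 0); rewrite big_ord0.
Qed.

Lemma idealmul_rcons a x v :
  v \in idealmul (rcons a x) V <-> exists w, v - x *: w \in idealmul a V.
Proof.
split=> [/idealmulP[w ->]|[w /idealmulP[w' vE]]].
  have lt1 : (size a < size (rcons a x))%N by rewrite size_rcons.
  exists (w (Ordinal lt1)); apply/idealmulP.
  exists (fun i => w (widen_ord (ltnW lt1) i)).
  move: w lt1; rewrite size_rcons => w lt1; rewrite big_ord_recr /=.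
  rewrite nth_rcons ltnn eqxx (_ : Ordinal lt1 = ord_max) ?addrK;
    last exact: val_inj.
  apply: eq_bigr => i _; rewrite nth_rcons ltn_ord.
  by congr (_ *: w _); apply: val_inj.
apply/idealmulP; rewrite size_rcons.
exists (fun i => if unlift ord_max i is Some j then w' j else w).
rewrite big_ord_recr /= unlift_none nth_rcons ltnn eqxx -[LHS](subrK (x *: w))
  vE.
congr (_ + _); apply: eq_bigr => i _; rewrite nth_rcons ltn_ord.
have -> : widen_ord (leqnSn (size a)) i = lift ord_max i.
  by apply: val_inj; rewrite /= /bump leqNgt ltn_ord.
by rewrite liftK.
Qed.

Lemma regular_quotm_injP a x :
  injective (fun u : quotm a V => x *: u) <->
  forall v : V, x *: v \in idealmul a V -> v \in idealmul a V.
Proof.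
split=> [inj v /quotm_pi_eq0|reg].
  rewrite quotm_piZ => xv0; apply/quotm_pi_eq0; apply: inj.
  by rewrite xv0 scaler0.
move=> u u'; rewrite -(quotm_piK u) -(quotm_piK u') -!quotm_piZ => /eqP.
by rewrite quotm_pi_eq -scalerBr => /reg; rewrite -quotm_pi_eq => /eqP.
Qed.

End Idealmul.

(** The ring [R + V] in which the product of two vectors is zero.  Polynomials
    over it contain the polynomials with coefficients in [V]. *)
Definition idealization (R : comNzRingType) (V : lmodType R) := (R * V)%type.

Section Idealization.
Variables (R : comNzRingType) (V : lmodType R).
Local Notation E := (idealization V).
HB.instance Definition _ := GRing.Zmodule.on E.

Definition idealization_mul (x y : E) : E :=
  (x.1 * y.1, x.1 *: y.2 + y.1 *: x.2).

Fact idealization_mulA : associative idealization_mul.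
Proof.
move=> x y t; congr (_, _); rewrite /= ?mulrA // !scalerDr !scalerA addrA.
by congr (_ *: _ + _ *: _ + _); rewrite mulrC.
Qed.

Fact idealization_mulC : commutative idealization_mul.
Proof. by move=> x y; congr (_, _); rewrite /= 1?mulrC // addrC. Qed.

Fact idealization_mul1 : left_id (1, 0) idealization_mul.
Proof.
by case=> p u; congr (_, _); rewrite /= ?mul1r // scale1r scaler0 addr0.
Qed.

Fact idealization_mulDl : left_distributive idealization_mul +%R.
Proof.
move=> x y t; congr (_, _); rewrite /= ?mulrDl // scalerDl scalerDr.
by rewrite addrACA.
Qed.

Fact idealization_1neq0 : (1, 0) != 0 :> E.
Proof. by apply/eqP => -[/eqP]; rewrite oner_eq0. Qed.

HB.instance Definition _ := GRing.Zmodule_isComNzRing.Build E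
  idealization_mulA idealization_mulC idealization_mul1 idealization_mulDl
  idealization_1neq0.

Definition ideal_scalar (p : R) : E := (p, 0).

Fact ideal_scalar_zmod : zmod_morphism ideal_scalar.
Proof. by move=> p q; congr (_, _); rewrite subr0. Qed.
Fact ideal_scalar_monoid : monoid_morphism ideal_scalar.
Proof. by split=> // p q; congr (_, _); rewrite /= !scaler0 addr0. Qed.
HB.instance Definition _ :=
  GRing.isZmodMorphism.Build R E ideal_scalar ideal_scalar_zmod.
HB.instance Definition _ :=
  GRing.isMonoidMorphism.Build R E ideal_scalar ideal_scalar_monoid.

Definition ideal_vector (v : V) : E := (0, v).

Fact ideal_vector_zmod : zmod_morphism ideal_vector.
Proof. by move=> u v; congr (_, _); rewrite subr0. Qed.
HB.instance Definition _ :=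
  GRing.isZmodMorphism.Build V E ideal_vector ideal_vector_zmod.

Lemma ideal_scalarM p v : ideal_scalar p * ideal_vector v =
  ideal_vector (p *: v).
Proof. by congr (_, _); rewrite /= ?mulr0 // scale0r addr0. Qed.

Definition vectors : set E := [set ideal_vector v | v in setT].

Lemma ideal_vector_inj : injective ideal_vector.
Proof. by move=> u v []. Qed.

Lemma vectors_subideal : subideal vectors.
Proof.
split; first by exists 0 => //; rewrite raddf0.
  by move=> _ _ [u _ <-] [v _ <-]; exists (u - v) => //; rewrite raddfB.
move=> [p u] _ [v _ <-]; exists (p *: v) => //; congr (_, _);
  rewrite /= ?mulr0 //.
by rewrite scale0r addr0.
Qed.

Definition ideal_vectors (a : seq R) : set E :=
  [set ideal_vector v | v in [set v | v \in idealmul a V]].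

Lemma ideal_vectors_rcons a x :
  ideal_vectors (rcons a x) = adjoin_mul (ideal_vectors a) (ideal_scalar x)
    vectors.
Proof.
apply/predeqP => e; split.
  case=> v /= /idealmul_rcons[w vw] <-; exists (ideal_vector w);
    first by exists w.
  by rewrite ideal_scalarM -raddfB; exists (v - x *: w).
case=> _ [w _ <-] [v /= va]; rewrite ideal_scalarM => vE.
exists (v + x *: w) => /=; first by apply/idealmul_rcons; exists w;
  rewrite addrK.
by rewrite raddfD /= vE subrK.
Qed.

Lemma regular_seq_weakly_regular a : regular_seq V a ->
  weakly_regular vectors [set 0] (map ideal_scalar a).
Proof.
case=> reg _.
have -> : [set 0] = ideal_vectors [::].
  apply/predeqP => e; split=> [->|[v /=]].
    by exists 0; rewrite ?raddf0 //= idealmul_nil.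
  by rewrite idealmul_nil => /eqP-> <-; rewrite raddf0.
have {reg}: forall i, (size (@nil R) <= i < size ([::] ++ a))%N -> forall v : V,
    ([::] ++ a)`_i *: v \in idealmul (take i ([::] ++ a)) V ->
    v \in idealmul (take i ([::] ++ a)) V.
  by move=> i /= lti; apply/regular_quotm_injP/reg.
elim: a [::] => [//|x a IH] s reg /=; split; last first.
  rewrite -ideal_vectors_rcons; apply: IH; rewrite size_rcons cat_rcons.
  by move=> i /andP[/ltnW s1 s2]; apply: reg; rewrite s1.
move=> _ [v _ <-]; rewrite ideal_scalarM => -[u /= us /ideal_vector_inj uE].
exists v => //=; have := reg (size s);
  rewrite size_cat /= nth_cat ltnn subnn /=.
rewrite take_size_cat // => -> //.
  by rewrite leqnn -[X in (X < _)%N]addn0 ltn_add2l.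
by rewrite -uE.
Qed.

End Idealization.

(** * Finite dimension of the graded components *)

Section KSpaces.
Variables (K : fieldType) (n : nat) (V : lmodType {mpoly K[n]}).

Definition klin d (b : 'I_d -> V) (c : 'rV[K]_d) : V :=
  \sum_(i < d) (c 0 i)%:MP *: b i.

Lemma klinB d (b : 'I_d -> V) c c' : klin b (c - c') = klin b c - klin b c'.
Proof.
by rewrite /klin -sumrB; apply: eq_bigr => i _; rewrite !mxE mpolyCB scalerBl.
Qed.

Lemma klin0 d (b : 'I_d -> V) : klin b 0 = 0.
Proof. by rewrite -(subrr 0) klinB subrr. Qed.

Lemma klin_mul d d' (b : 'I_d -> V) (b' : 'I_d' -> V) (P : 'M[K]_(d', d)) c :
  (forall i, b' i = klin b (row i P)) -> klin b' c = klin b (c *m P).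
Proof.
move=> b'E; rewrite {1}/klin; under eq_bigr do rewrite b'E /klin scaler_sumr.
rewrite exchange_big; apply: eq_bigr => j _;
  rewrite !mxE rmorph_sum scaler_suml.
by apply: eq_bigr => i _; rewrite scalerA -mpolyCM mxE.
Qed.

Definition kspace (A : set V) : Prop :=
  [/\ A 0, forall u v, A u -> A v -> A (u + v) & forall c v, A v ->
    A (c%:MP *: v)].

Lemma kspace_sum (A : set V) (I : Type) (r : seq I) (P : pred I) (F : I -> V) :
  kspace A -> (forall i, P i -> A (F i)) -> A (\sum_(i <- r | P i) F i).
Proof. by case=> A0 AD _ AF; apply: (big_ind A). Qed.

Lemma kspace_klin (A : set V) d (b : 'I_d -> V) c :
  kspace A -> (forall i, A (b i)) -> A (klin b c).
Proof.
by move=> sA Ab; apply: kspace_sum => // i _; case: sA => _ _; apply.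
Qed.

(** Unique coordinates, split into generation and linear independence. *)
Lemma has_kdimP (A : set V) d : kspace A ->
  has_kdim A d <->
  exists b : 'I_d -> V, [/\ forall i, A (b i), forall v, A v ->
    exists c, v = klin b c
     & forall c, klin b c = 0 -> c = 0].
Proof.
move=> sA; split=> -[b].
  case=> Ab bu; exists b; split=> // [v /bu[c [vE _]]|c bc0]; first by exists c.
  have [|c' [_ c'u]] := bu 0; first by case: sA.
  by rewrite -(c'u 0) ?(c'u c) //; rewrite -/(klin _ _) ?klin0.
case=> Ab bs bf; exists b; split=> // v /bs[c vE]; exists c; split=> // c' c'E.
by apply/eqP; rewrite -subr_eq0; apply/eqP/bf; rewrite klinB -vE [v]c'E subrr.
Qed.

(** The two change-of-basis matrices compose to the identity. *)
Lemma has_kdim_uniq (A : set V) d d' : kspace A ->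
  has_kdim A d -> has_kdim A d' -> d = d'.
Proof.
move=> sA; wlog suff le_dd' : d d' / has_kdim A d -> has_kdim A d' ->
  (d <= d')%N.
  by move=> Ad Ad'; apply/eqP; rewrite eqn_leq !le_dd'.
move=> /(has_kdimP _ sA)[b [Ab bs bf]] /(has_kdimP _ sA)[b' [Ab' bs' _]].
have /choice[P PE] i : exists c, b i = klin b' c by apply: bs'.
have /choice[Q QE] i : exists c, b' i = klin b c by apply: bs.
have PE' i : b i = klin b' (row i (\matrix_i P i)) by rewrite rowK.
have QE' i : b' i = klin b (row i (\matrix_i Q i)) by rewrite rowK.
apply: (@mulmx1_min _ _ _ (\matrix_i P i) (\matrix_i Q i)).
apply/row_matrixP => i; apply/eqP; rewrite -subr_eq0; apply/eqP/bf.
rewrite klinB rowE -[_ *m (_ *m _)]rowE row_mul -(klin_mul _ QE') -PE'.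
rewrite row1 /klin (bigD1 i) //= big1 ?addr0 => [|j neij].
  by rewrite mxE !eqxx mpolyC1 scale1r subrr.
by rewrite mxE (negPf neij) andbF mpolyC0 scale0r.
Qed.

Lemma kdimE (A : set V) d : kspace A -> has_kdim A d -> kdim A = d.
Proof.
move=> sA Ad; rewrite /kdim; case: xgetP => [e -> /= Ae|/(_ d)//].
exact: has_kdim_uniq Ae Ad.
Qed.

Lemma has_kdim_kdim (A : set V) d : has_kdim A d -> has_kdim A (kdim A).
Proof. by move=> Ad; rewrite /kdim; case: xgetP => [e -> //|/(_ d)]. Qed.

(** A spanning family of minimal length is a basis: a nontrivial relation would
    allow one member to be dropped. *)
Lemma has_kdim_span (A : set V) (I : finType) (L : I -> V) : kspace A ->
  (forall x, A (L x)) ->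
  (forall v, A v -> exists c : I -> K, v = \sum_x (c x)%:MP *: L x) ->
  exists d, has_kdim A d.
Proof.
move=> sA AL Ls.
pose spans d := `[< exists b : 'I_d -> V, (forall i, A (b i)) /\
  forall v, A v -> exists c, v = klin b c >].
have ex_spans : exists d, spans d.
  exists #|I|; apply/asboolP; exists (fun i => L (enum_val i));
    split=> // v /Ls[c ->].
  exists (\row_i c (enum_val i));
    rewrite (reindex _ (onW_bij _ (@enum_val_bij I))).
  by apply: eq_bigr => i _; rewrite mxE.
have [d /asboolP[b [Ab bs]] dmin] := ex_minnP ex_spans; exists d.
apply/has_kdimP => //; exists b; split=> // c bc0; apply/rowP => j; rewrite mxE.
apply/eqP/negP => /negP nzc; case: d => [|d] in b Ab bs dmin c bc0 j nzc *.
  by case: j nzc.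
suff /dmin : spans d by rewrite ltnn.
apply/asboolP; exists (fun i => b (lift j i)); split=> // v /bs[e ->].
exists (\row_i (e 0 (lift j i) - e 0 j / c 0 j * c 0 (lift j i))).
rewrite -[LHS]subr0 -[X in _ - X](scaler0 _ (e 0 j / c 0 j)%:MP) -bc0 /klin.
rewrite scaler_sumr -sumrB (bigD1_ord j) //= scalerA -mpolyCM divfK // subrr
  add0r.
apply: eq_bigr => i _; rewrite scalerA -scalerBl -mpolyCM -mpolyCB.
by rewrite mxE.
Qed.

End KSpaces.

Section GradedModules.
Variables (K : fieldType) (n : nat) (N : grmod K n).

Lemma gm_degC i c (v : N) : gm_deg i v -> gm_deg i (c%:MP *: v).
Proof.
have c_homog : (c%:MP : {mpoly K[n]}) \is 0.-homog.
  by rewrite -[c%:MP]mulr1 mul_mpolyC dhomogZ // dhomog1.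
by move=> /(gm_degZ c_homog); rewrite addr0.
Qed.

Lemma gm_deg_kspace i : kspace (@gm_deg _ _ N i).
Proof.
split; [exact: gm_deg0|by move=> u v; apply: gm_degD|].
by move=> c v; apply: gm_degC.
Qed.

(** By directness of the grading, the terms of the wrong degrees cancel. *)
Lemma homog_component (I : eqType) (r : seq I) (D : I -> int) (F : I -> N) i :
  (forall x, gm_deg (D x) (F x)) -> gm_deg i (\sum_(x <- r) F x) ->
  \sum_(x <- r) F x = \sum_(x <- r | D x == i) F x.
Proof.
move=> DF Dv; pose s := undup (i :: map D r).
pose f j := \sum_(x <- r | D x == j) F x - (if j == i then \sum_(x <- r) F x
  else 0).
have direct := @gm_direct _ _ N s f (undup_uniq _).
suff : f i = 0 by rewrite /f eqxx => /eqP; rewrite subr_eq0 eq_sym => /eqP.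
apply: direct => [j||]; last by rewrite mem_undup mem_head.
  apply: gm_degD; first by apply: (kspace_sum _ (gm_deg_kspace j)) => x /eqP <-.
  case: eqP => [->|_]; last by rewrite oppr0; apply: gm_deg0.
  by rewrite -scaleN1r -mpolyC1 -mpolyCN; apply: gm_degC.
have us : uniq s by apply: undup_uniq.
have sum_at (x : N) j : j \in s -> \sum_(k <- s | k == j) x = x.
  move=> js; rewrite big_mkcond (bigD1_seq j) //= eqxx big1 ?addr0 // => k.
  by case: eqP.
rewrite sumrB -big_mkcond /= sum_at; last by rewrite mem_undup mem_head.
apply/eqP; rewrite subr_eq0; apply/eqP.
rewrite (exchange_big_dep xpredT) //= [LHS]big_seq [RHS]big_seq.
apply: eq_bigr => x xr; rewrite (eq_bigl (fun k => k == D x)); last first.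
  by move=> k; rewrite eq_sym.
by apply: sum_at; rewrite mem_undup inE map_f // orbT.
Qed.

(** The homogeneous components of finitely many generators. *)
Lemma fingen_homog : fingen N -> exists (J : finType) (e : J ->
  int) (g : J -> N),
  (forall j, gm_deg (e j) (g j)) /\
  forall v, exists c : J -> {mpoly K[n]}, v = \sum_j c j *: g j.
Proof.
case=> s s_gen.
have /choice[tf tfP] (j : 'I_(size s)) : exists tf : seq int * (int -> N),
    (forall i, gm_deg i (tf.2 i)) /\ s`_j = \sum_(i <- tf.1) tf.2 i.
  by have [t [f [_ ft sE]]] := gm_span s`_j; exists (t, f).
pose J : finType := {j : 'I_(size s) & 'I_(size (tf j).1)}.
pose e (x : J) : int := let: existT j k := x in (tf j).1`_k.
exists J, e, (fun x => (tf (tag x)).2 (e x)); split=> [x|v].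
  by case: (tfP (tag x)).
have [c ->] := s_gen v; exists (fun x => c (tag x)).
transitivity (\sum_j \sum_(k < size (tf j).1) c j *: (tf j).2 (tf j).1`_k).
  apply: eq_bigr => j _; have [_ {1}->] := tfP j.
  by rewrite scaler_sumr (big_nth 0) big_mkord.
by rewrite sig_big_dep /=; apply: eq_big => -[j k].
Qed.

(** The component of degree [i] is spanned by the products of homogeneous
    generators with monomials of complementary degree,
      and [B] bounds the degrees
    of these monomials.  This makes [hilbert] meaningful: without a finite basis
    [kdim] would take its default value 0. *)
Theorem fingen_has_kdim i : fingen N -> exists d, has_kdim (@gm_deg _ _ N i) d.
Proof.
case/fingen_homog=> J [e [g [eg g_gen]]].
pose B := (\max_j `|i - e j|.+1)%N.
pose L (x : J * 'X_{1..n < B}) : N :=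
  if (mdeg x.2)%:Z + e x.1 == i then 'X_[x.2] *: g x.1 else 0.
apply: (has_kdim_span (L := L) (gm_deg_kspace i)) => [[j m]|v vi];
  rewrite /L /=.
  case: eqP => [<-|_]; last exact: gm_deg0.
  by rewrite addrC; apply: gm_degZ => //; rewrite dhomogX.
have [c vE] := g_gen v.
pose p j : {mpoly K[n]} := if i - e j is Posz d then pihomog mdeg d (c j) else
  0.
have {}vE : v = \sum_j p j *: g j.
  pose M := (\max_j (msize (c j) + B))%N.
  have cM j : (msize (c j) + B <= M)%N
    by apply: (leq_bigmax_cond (F := fun j => (msize (c j) + B)%N)).
  have vE' : v = \sum_(x : J * 'I_M) pihomog mdeg x.2 (c x.1) *: g x.1.
    rewrite vE -(pair_big xpredT xpredT (fun j (d :
      'I_M) => pihomog mdeg d (c j) *: g j)) /=.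
    apply: eq_bigr => j _; rewrite -scaler_suml -pihomog_partitionE //.
    exact: leq_trans (leq_addr _ _) (cM j).
  move: vi; rewrite vE' => vi.
  rewrite (homog_component (D := fun x => e x.1 + (nat_of_ord x.2)%:Z) _ vi);
    last first.
    by move=> x; apply: gm_degZ => //; apply: pihomogP.
  rewrite -(pair_big_dep xpredT (fun j (d : 'I_M) => e j + d%:Z == i)
     (fun j (d : 'I_M) => pihomog mdeg d (c j) *: g j)) /=.
  apply: eq_bigr => j _; rewrite /p; case ed: (i - e j) => [d|d].
    have dM : (d < M)%N.
      apply: leq_trans (cM j); apply: ltn_addl.
      have := leq_bigmax_cond (F := fun j => (`|i - e j|.+1)%N) j isT;
        rewrite ed; exact.
    rewrite (big_pred1 (Ordinal dM)) // => k; rewrite /= -(inj_eq val_inj) /=;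
      lia.
  rewrite big_pred0 ?scale0r // => k; lia.
have pB j : (msize (p j) <= B)%N.
  rewrite /p; case ed: (i - e j) => [d|d]; last by rewrite msize0.
  have ltdB : (d < B)%N.
    have := leq_bigmax_cond (F := fun j => (`|i - e j|.+1)%N) j isT;
      rewrite ed; exact.
  apply: leq_trans ltdB; rewrite msizeE; apply/bigmax_leqP_seq => m mp _.
  by rewrite (dhomog_mf (pihomogP mdeg d (c j)) mp).
exists (fun x : J * 'X_{1..n < B} => (p x.1)@_(x.2)).
rewrite -(pair_big xpredT xpredT (fun j (m : 'X_{1..n < B}) =>
  ((p j)@_m)%:MP *: L (j, m))) vE /=; apply: eq_bigr => j _.
rewrite [in LHS](mpolywE (pB j)) scaler_suml; apply: eq_bigr => m _ /=.
rewrite -mul_mpolyC -scalerA /L /=; case: eqP => // neq; suff -> : (p j)@_m = 0.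
  by rewrite mpolyC0 !scale0r.
move: neq; rewrite /p; case ed: (i - e j) => [d|d] ne; last by rewrite mcoeff0.
apply: (dhomog_nemf_coeff (pihomogP mdeg d (c j))); apply/eqP => mE.
by apply: ne; rewrite mE -ed subrK.
Qed.

End GradedModules.

(** * Positivity of the iterated differences of a Hilbert function *)

Section ModuleFrame.
Variables (K : fieldType) (n : nat) (N : grmod K n).
Hypothesis N_fin : fingen N.
Hypothesis N_pos : forall i : int, i < 0 -> hilbert N i = 0%N.
Local Notation E := (idealization N).
Let h (k : nat) := hilbert N k.
Let emb := (@ideal_scalar _ N \o @mpolyC n K).

Lemma hilbert_basis i : exists b : 'I_(hilbert N i) -> N,
  [/\ forall j, gm_deg i (b j), forall v, gm_deg i v -> exists c, v = klin b c
    & forall c, klin b c = 0 -> c = 0].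
Proof.
apply/(has_kdimP _ (gm_deg_kspace N i)); have [d] := fingen_has_kdim i N_fin.
exact: has_kdim_kdim.
Qed.

Let basis k : 'I_(h k) -> N := projT1 (cid (hilbert_basis k)).

Let basis_deg (k : nat) j : gm_deg k (@basis k j).
Proof. by rewrite /basis; case: cid => b []. Qed.

Let basis_span (k : nat) v : gm_deg k v -> exists c, v = klin (@basis k) c.
Proof. by rewrite /basis; case: cid => b [] /= _ bs _; apply: bs. Qed.

Let basis_free k c : klin (@basis k) c = 0 -> c = 0.
Proof. by rewrite /basis; case: cid c => b [] /= _ _ bf c; apply: bf. Qed.

Let beta k (j : 'I_(h k)) : E := ideal_vector (basis j).

Let comb_klin k v : comb emb beta v = ideal_vector (klin (@basis k) v).
Proof.
by rewrite raddf_sum; apply: eq_bigr => i _; rewrite /= ideal_scalarM.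
Qed.

Let neg_deg i (v : N) : gm_deg i v -> i < 0 -> v = 0.
Proof.
move=> vi lti0; have [b [_ bs _]] := hilbert_basis i.
have [c ->] := bs v vi; apply: big1 => -[j lt] _.
by exfalso; rewrite N_pos in lt.
Qed.

(** A choice of bases of the components of [N]; the absence of negative degrees
    lets natural numbers index them. *)
Lemma module_frame : exists Z,
  graded_frame emb beta (@vectors _ N) (fun a => ideal_scalar N 'X_a) Z.
Proof.
have coord k a (j : 'I_(h k)) : exists c, 'X_a *: basis j =
  klin (@basis k.+1) c.
  apply: basis_span; rewrite -addn1; apply: gm_degZ (basis_deg j).
  by rewrite dhomogX /= mdeg1.
exists (fun a k => \matrix_j projT1 (cid (coord k a j))); split.
- exact: vectors_subideal.
- move=> D v; under eq_bigr do rewrite comb_klin.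
  rewrite -raddf_sum -(raddf0 (@ideal_vector _ N)) => /ideal_vector_inj v0 k
    ltkD.
  pose f (i : int) : N := if i is Posz j then klin (@basis j) (v j) else 0.
  have us : uniq [seq Posz j | j <- seq.iota 0 D].
    by rewrite map_inj_uniq ?iota_uniq // => x y [].
  apply/basis_free/(gm_direct us (f := f) _ _ (x := Posz k)).
  + case=> j /=; last exact: gm_deg0.
    exact: kspace_klin (gm_deg_kspace N j) (@basis_deg j).
  + by rewrite big_map -[X in seq.iota _ X]subn0 -/(index_iota _ _) big_mkord.
  + by rewrite map_f // mem_iota.
- by move=> k v; rewrite comb_klin; exists (klin (@basis k) v).
- move=> _ [u _ <-]; have [s [f [us fd ->]]] := gm_span u.
  pose c (k : nat) := projT1 (cid (basis_span (fd k))).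
  have cE (k : nat) : f k = klin (@basis k) (c k) by rewrite /c; case: cid.
  pose D := (\max_(i <- s) `|i|.+1)%N.
  exists D, (fun k => if Posz k \in s then c k else 0).
  under [RHS]eq_bigr do rewrite comb_klin.
  rewrite -raddf_sum; congr ideal_vector.
  transitivity (\sum_(i <- [seq Posz k | k <- seq.iota 0 D
    & Posz k \in s]) f i).
    rewrite (bigID (fun i => 0 <= i)) /= [X in _ + X]big1 ?addr0; last first.
      by move=> i; rewrite -ltNge => /(neg_deg (fd i)).
    rewrite -big_filter; apply: perm_big; apply: uniq_perm.
    - exact: filter_uniq.
    - rewrite map_inj_uniq ?filter_uniq ?iota_uniq // => x y [] //.
    move=> i; rewrite mem_filter; apply/andP/mapP.
      case: i => [k|k] [i_ge0 ks] //; exists k => //;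
        rewrite mem_filter ks mem_iota /=.
      exact: (leq_bigmax_seq (P := xpredT) (F :=
        fun i : int => `|i|.+1) k ks isT).
    by case=> k; rewrite mem_filter => /andP[ks _] ->.
  rewrite big_map big_filter -[X in seq.iota _ X]subn0 -/(index_iota _ _)
    big_mkord.
  rewrite big_mkcond; apply: eq_bigr => k _.
  by case: ifP => _; rewrite ?cE // klin0.
- move=> a k j; rewrite ideal_scalarM comb_klin; congr ideal_vector.
  by rewrite rowK; case: cid.
Qed.

Lemma maxideal_lin_comb p : p \in @maxideal K n ->
  lin_comb (fun a => ideal_scalar N 'X_a) (ideal_scalar N p).
Proof.
move=> /idealmulP[w ->]; apply: (big_ind (fun p => lin_comb _ (ideal_scalar N
  p))).
- by exists (fun=> 0); rewrite raddf0 big1 // => a _; rewrite mul0r.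
- move=> q r [c cE] [c' c'E]; exists (fun a => c a + c' a).
  rewrite raddfD /= cE c'E -big_split; apply: eq_bigr => a _ /=.
  by rewrite mulrDl.
move=> i _; have /mapP[a _ ->] := mem_nth 0 (ltn_ord i).
exists (fun b => if b == a then ideal_scalar N (w i) else 0).
rewrite (bigD1 a) //= eqxx big1 ?addr0 => [|b /negPf->]; last by rewrite mul0r.
by rewrite -rmorphM mulrC.
Qed.

(** The case of [diff_ge0] for the idealization of [N] over the domain [K], with
    no linear forms at the start. *)
Theorem regular_seq_diff_ge0 (a : seq {mpoly K[n]}) :
  {subset a <= @maxideal K n} -> regular_seq N a ->
  forall k, 0 <= iter (size a) backward_diff (fun k => (hilbert N k)%:Z) k.
Proof.
move=> a_max /regular_seq_weakly_regular a_reg k.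
have [Z fr] := module_frame.
have := @diff_ge0 h n K E emb beta _ _ Z [::] _ fr _ a_reg k.
rewrite size_map; apply=> _ /mapP[p /a_max pa ->].
exact: maxideal_lin_comb.
Qed.

End ModuleFrame.

(** * Hilbert functions of monomial quotients *)

Section MonomialQuotient.
Variables (K : fieldType) (n : nat).
Local Notation S := {mpoly K[n]}.

Definition in_mono (ms : seq 'X_{1..n}) (m : 'X_{1..n}) : bool :=
  has (fun g => (g <= m)%MM) ms.

(** Membership in a monomial ideal is decided monomial by monomial. *)
Lemma idealmul_monoP (ms : seq 'X_{1..n}) (p : S) :
  p \in idealmul [seq 'X_[m] | m <- ms] S^o <->
    {in msupp p, forall m, in_mono ms m}.
Proof.
split.
  case/idealmulP=> w -> m /msupp_sum_le/flattenP[_ /mapP[i _ ->]].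
  have ltis : (i < size ms)%N by rewrite -[X in (_ < X)%N](size_map (fun m =>
    'X_[m] : S)).
  rewrite (nth_map 0%MM) // [_ *: _]mulrC.
  rewrite (perm_mem (msuppMX _ _)) => /mapP[m' _ ->].
  by apply/hasP; exists (nth 0%MM ms i); rewrite ?mem_nth // lem_addr.
move=> pms; rewrite [p]mpolyE big_seq;
  apply: rpred_sum => m /pms/hasP[g gms le_gm].
rewrite -(submK le_gm) mpolyXD scalerAl; apply: idealmulZ.
have := index_mem g ms; rewrite gms => lt_g; apply/idealmulP.
have lt_g' : (index g ms < size [seq 'X_[m] : S | m <- ms])%N
  by rewrite size_map.
exists (fun i => if i == Ordinal lt_g' then 1 else 0).
rewrite (bigD1 (Ordinal lt_g')) //= eqxx big1 ?addr0 => [|i /negPf->];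
  last exact: scaler0.
by rewrite (nth_map 0%MM) // nth_index // [_ *: _]mulr1.
Qed.

(** The classes of the standard monomials, those outside the ideal, form a
    basis. *)
Lemma has_kdim_mono (a : seq S) (a_homog : {in a, forall p, p \is homog mdeg})
    (ms : seq 'X_{1..n}) d (L : seq 'X_{1..n}) :
  a = [seq 'X_[m] | m <- ms] -> uniq L ->
  (forall m, (m \in L) = (mdeg m == d) && ~~ in_mono ms m) ->
  has_kdim (@gm_deg _ _ (grquot a_homog) d) (size L).
Proof.
move=> aE uL LE.
have coefL (c : 'rV[K]_(size L)) m :
  (\sum_(i < size L) c 0 i *: 'X_[nth 0%MM L i] : S)@_m =
    if m \in L then (if insub (index m L) is Some i then c 0 i else 0) else 0.
  rewrite linear_sum /=; under eq_bigr do rewrite mcoeffZ mcoeffX.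
  case: ifP => mL; last first.
    rewrite big1 // => i _; case: eqP => [e|_]; last by rewrite mulr0.
    by rewrite -e mem_nth in mL.
  have lti : (index m L < size L)%N by rewrite index_mem.
  rewrite insubT (bigD1 (Ordinal lti)) //= nth_index // eqxx mulr1 big1 ?addr0
    // => i.
  rewrite -(inj_eq val_inj) /= => nei; case: eqP => [e|_];
    last by rewrite mulr0.
  by rewrite -e index_uniq ?eqxx in nei.
have klin_pi (c : 'rV[K]_(size L)) :
    klin (fun i : 'I_(size L) => quotm_pi ('X_[nth 0%MM L i] : S^o) :
      grquot a_homog) c =
    quotm_pi (\sum_(i < size L) c 0 i *: 'X_[nth 0%MM L i] : S^o).
  rewrite (raddf_sum quotm_pi); apply: eq_bigr => i _.
  by rewrite -mul_mpolyC -quotm_piZ.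
apply/(has_kdimP _ (gm_deg_kspace _ _)).
exists (fun i => quotm_pi ('X_[nth 0%MM L i] : S^o)); split=> [i|v [p hp ->]|c].
- exists ('X_[nth 0%MM L i] : S) => //=; rewrite dhomogX.
  by have := mem_nth 0%MM (ltn_ord i); rewrite LE => /andP[].
- exists (\row_(i < size L) p@_(nth 0%MM L i)); apply/eqP;
  rewrite klin_pi quotm_pi_eq aE.
  apply/idealmul_monoP => m; rewrite mcoeff_msupp mcoeffB coefL LE.
  case: (boolP (in_mono ms m)) => // nm; rewrite andbT;
    have [md|md] := eqVneq (mdeg m) d.
    have lti : (index m L < size L)%N by rewrite index_mem LE md eqxx.
    by rewrite insubT mxE /= nth_index ?subrr ?eqxx // -index_mem.
  by rewrite subr0 (dhomog_nemf_coeff hp md) eqxx.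
rewrite klin_pi => /quotm_pi_eq0; rewrite aE => /idealmul_monoP H.
apply/rowP => i; rewrite mxE; apply/eqP/negP => /negP nz.
have iL := mem_nth 0%MM (ltn_ord i); have := H (nth 0%MM L i).
move: (iL); rewrite LE => /andP[_ /negPf->]; rewrite mcoeff_msupp coefL iL.
by rewrite index_uniq ?ltn_ord // valK => /(_ nz).
Qed.

End MonomialQuotient.

Section Monomials.
Variable n : nat.
Local Notation monom := 'X_{1..n.+1}.

(** The monomials of degree [d] in the first [e] variables, listed according to
    whether the last of these variables occurs; this matches Pascal's rule
    [multichooseS]. *)
Fixpoint monomials (e : nat) : nat -> seq monom :=
  if e is e'.+1 then
    fix go d := monomials e' d ++
      (if d is d'.+1 then [seq (m + U_(inord e'))%MM | m <- go d'] else [::])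
  else fun d => nseq (d == 0%N) 0%MM.

Lemma monomialsS e d : monomials e.+1 d.+1 =
  monomials e d.+1 ++ [seq (m + U_(inord e))%MM | m <- monomials e.+1 d].
Proof. by []. Qed.

Lemma size_monomials e d : size (monomials e d) = multichoose e d.
Proof.
elim: e d => [|e IHe] d; first by rewrite size_nseq multichoose_0n.
elim: d => [|d IHd]; first by rewrite /= cats0 IHe !multichoose_n0.
by rewrite monomialsS size_cat size_map IHe IHd multichooseS.
Qed.

Lemma mem_monomials e d m : (e <= n.+1)%N ->
  (m \in monomials e d) = (mdeg m == d) && [forall i : 'I_n.+1,
    (e <= i)%N ==> (m i == 0%N)].
Proof.
elim: e d m => [|e IHe] d m le_en.
  have -> : [forall i : 'I_n.+1, (0 <= i)%N ==> (m i == 0%N)] = (m == 0%MM).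
    apply/forallP/eqP => [m0|-> i]; last by rewrite mnm0E.
    by apply/mnmP => i; rewrite mnm0E; apply/eqP/m0.
  case: d => [|d]; first by rewrite inE -mdeg_eq0 andbb.
  by rewrite -mdeg_eq0; case: eqP => // ->.
have eE : nat_of_ord (inord e : 'I_n.+1) = e by rewrite inordK.
have split_e (m0 : monom) : [forall i : 'I_n.+1, (e <= i)%N ==> (m0 i == 0%N)] =
    (m0 (inord e) == 0%N) && [forall i : 'I_n.+1,
      (e.+1 <= i)%N ==> (m0 i == 0%N)].
  apply/forallP/andP => [H|[m0e /forallP H] i].
    split; first by apply: (implyP (H _)); rewrite eE.
    by apply/forallP => i; apply/implyP => /ltnW; apply/implyP.
  apply/implyP; rewrite leq_eqVlt => /orP[/eqP ei|]; last by apply/implyP.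
  by have -> : i = inord e by apply: val_inj; rewrite /= eE.
elim: d m => [|d IHd] m.
  rewrite [monomials _ _]/= cats0 IHe ?(ltnW le_en) // split_e.
  by case: eqP => // /eqP; rewrite mdeg_eq0 => /eqP->; rewrite mnm0E.
rewrite monomialsS mem_cat IHe ?(ltnW le_en) // split_e.
have [m0|m0] := eqVneq (m (inord e)) 0%N.
  rewrite /= orbC; case: mapP => //= -[m' _ mE]; move: m0.
  by rewrite mE mnmDE mnm1E eqxx addn1.
rewrite andbF /=.
have le_em : (U_(inord e) <= m)%MM by rewrite lep1mP.
have -> : (m \in [seq (m + U_(inord e))%MM | m <- monomials e.+1 d]) =
    ((m - U_(inord e))%MM \in monomials e.+1 d).
  apply/mapP/idP => [[m' m'M ->]|mM]; first by rewrite addmK.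
  by exists (m - U_(inord e))%MM; rewrite ?submK.
move: (submK le_em); move: (m - _)%MM => m' <-.
rewrite IHd mdegD mdeg1 addn1 eqSS; congr (_ && _).
apply: eq_forallb => i; rewrite mnmDE mnm1E.
case: ltnP => //= lt_ei; have [ei|_] := eqVneq (inord e) i;
  last by rewrite addn0.
by move: lt_ei; rewrite -ei eE ltnn.
Qed.

Lemma uniq_monomials e d : (e <= n.+1)%N -> uniq (monomials e d).
Proof.
elim: e d => [|e IHe] d le_en; first by case: d.
have eE : nat_of_ord (inord e : 'I_n.+1) = e by rewrite inordK.
elim: d => [|d IHd]; first by rewrite /= cats0 IHe // ltnW.
rewrite monomialsS cat_uniq IHe ?(ltnW le_en) // map_inj_uniq ?IHd;
  last exact: addIm.
rewrite andbT; apply/hasPn => _ /mapP[m _ ->];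
  rewrite mem_monomials ?(ltnW le_en) //.
apply/nandP; right; rewrite negb_forall; apply/existsP; exists (inord e).
by rewrite eE leqnn mnmDE mnm1E eqxx addn1.
Qed.

End Monomials.

(** * Shifts and direct sums of graded modules *)

(** Generators indexed by a finite type, which combine more easily than
    sequences. *)
Lemma fingenP (R : comNzRingType) (V : lmodType R) :
  fingen V <-> exists (J : finType) (g : J -> V),
    forall v, exists c : J -> R, v = \sum_j c j *: g j.
Proof.
split=> [[s s_gen]|[J [g g_gen]]].
  by exists 'I_(size s), (fun i : 'I_(size s) => s`_i).
pose s := mkseq (fun k => if insub k is Some i then g (enum_val (i :
  'I_#|J|)) else 0) #|J|.
exists s => v; have [c ->] := g_gen v.
exists (fun k => if insub (nat_of_ord k) is Some i then c (enum_val (i :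
  'I_#|J|)) else 0).
rewrite size_mkseq (reindex _ (onW_bij _ (@enum_val_bij J))) /=.
by apply: eq_bigr => i _; rewrite nth_mkseq // valK.
Qed.

Section Shift.
Variables (K : fieldType) (n : nat) (M : grmod K n) (b : int).

Definition shift_deg (i : int) : set M := gm_deg (i - b).

Fact shift_degZ i d (p : {mpoly K[n]}) v :
  p \is d.-homog -> shift_deg i v -> shift_deg (i + d%:Z) (p *: v).
Proof. by move=> hp hv; rewrite /shift_deg addrAC; apply: gm_degZ. Qed.

Fact shift_span v : exists (s : seq int) (f : int -> M),
  [/\ uniq s, forall i, shift_deg i (f i) & v = \sum_(i <- s) f i].
Proof.
have [s [f [us fd ->]]] := gm_span v.
exists [seq i + b | i <- s], (fun i => f (i - b)); split.
- by rewrite map_inj_uniq //; apply: addIr.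
- by move=> i; apply: fd.
by rewrite big_map; apply: eq_bigr => i _; rewrite addrK.
Qed.

Fact shift_direct (s : seq int) (f : int -> M) :
  uniq s -> (forall i, shift_deg i (f i)) -> \sum_(i <- s) f i = 0 ->
  {in s, forall i, f i = 0}.
Proof.
move=> us fd s0 i si; rewrite -[i](subrK b).
apply: (@gm_direct _ _ M [seq i - b | i <- s] (fun i => f (i + b))).
- by rewrite map_inj_uniq //; apply: addIr.
- by move=> j; have := fd (j + b); rewrite /shift_deg addrK.
- by rewrite big_map; under eq_bigr do rewrite subrK.
- exact: map_f.
Qed.

Definition grshift : grmod K n :=
  Grmod (fun i => @gm_deg0 _ _ M (i - b)) (fun i => @gm_degD _ _ M (i - b))
    shift_degZ shift_span shift_direct.

Lemma hilbert_grshift i : hilbert grshift i = hilbert M (i - b).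
Proof. by []. Qed.

End Shift.

Section DirectSum.
Variables (K : fieldType) (n : nat) (M N : grmod K n).

Definition sum_deg (i : int) : set (M * N)%type :=
  [set u | gm_deg i u.1 /\ gm_deg i u.2].

Fact sum_deg0 i : sum_deg i 0.
Proof. by split; apply: gm_deg0. Qed.

Fact sum_degD i u v : sum_deg i u -> sum_deg i v -> sum_deg i (u + v).
Proof. by move=> [? ?] [? ?]; split; apply: gm_degD. Qed.

Fact sum_degZ i d (p : {mpoly K[n]}) v :
  p \is d.-homog -> sum_deg i v -> sum_deg (i + d%:Z) (p *: v).
Proof. by move=> hp [? ?]; split; apply: gm_degZ. Qed.

(** A decomposition into homogeneous components may be padded by zeros, so two
    of them can be given the same set of degrees. *)
Lemma gm_span_on (L : grmod K n) (v : L) : exists s : seq int,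
  forall t, uniq t -> {subset s <= t} ->
  exists f, (forall i, gm_deg i (f i)) /\ v = \sum_(i <- t) f i.
Proof.
have [s [f [us fd ->]]] := gm_span v; exists s => t ut st.
exists (fun i => if i \in s then f i else 0); split=> [i|].
  by case: ifP => _; [apply: fd | apply: gm_deg0].
rewrite -big_mkcond -big_filter; apply/perm_big/uniq_perm => //.
  exact: filter_uniq.
by move=> i; rewrite mem_filter andbC; case: (boolP (i \in s)) => [/st->|];
  rewrite ?andbF.
Qed.

Fact sum_span (v : (M * N)%type) : exists (s : seq int) (f : int ->
  (M * N)%type),
  [/\ uniq s, forall i, sum_deg i (f i) & v = \sum_(i <- s) f i].
Proof.
have [s Hs] := gm_span_on v.1; have [t Ht] := gm_span_on v.2.
have ust := undup_uniq (s ++ t).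
have [|f [fd fE]] := Hs _ ust.
  by move=> i si; rewrite mem_undup mem_cat si.
have [|g [gd gE]] := Ht _ ust.
  by move=> i si; rewrite mem_undup mem_cat si orbT.
exists (undup (s ++ t)), (fun i => (f i, g i)); split=> //.
rewrite [v]surjective_pairing fE gE.
by elim: (undup _) => [|i r IH]; rewrite ?big_nil // !big_cons -IH.
Qed.

Fact sum_direct (s : seq int) (f : int -> (M * N)%type) :
  uniq s -> (forall i, sum_deg i (f i)) -> \sum_(i <- s) f i = 0 ->
  {in s, forall i, f i = 0}.
Proof.
move=> us fd s0 i si; rewrite [f i]surjective_pairing; congr (_, _).
  apply: (gm_direct us (f := fun i => (f i).1)) si; first by move=> j;
    case: (fd j).
  by rewrite -(raddf_sum fst) s0.
apply: (gm_direct us (f := fun i => (f i).2)) si; first by move=> j;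
  case: (fd j).
by rewrite -(raddf_sum snd) s0.
Qed.

Definition grsum : grmod K n :=
  Grmod sum_deg0 sum_degD sum_degZ sum_span sum_direct.

Lemma fingen_grsum : fingen M -> fingen N -> fingen grsum.
Proof.
move=> /fingenP[J [g g_gen]] /fingenP[J' [g' g'_gen]]; apply/fingenP.
exists (J + J')%type.
exists (fun x => match x with inl j => (g j, 0) | inr j => (0,
  g' j) end) => -[u v].
have [c ->] := g_gen u; have [c' ->] := g'_gen v.
exists (fun x => match x with inl j => c j | inr j => c' j end).
rewrite big_sumType /=; rewrite [RHS]surjective_pairing /=; congr (_, _).
  rewrite !(raddf_sum fst) /= [X in _ + X]big1 ?addr0 // => j _; exact: scaler0.
rewrite !(raddf_sum snd) /= [X in X + _]big1 ?add0r // => j _; exact: scaler0.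
Qed.

Lemma hilbert_grsum i : fingen M -> fingen N ->
  hilbert grsum i = (hilbert M i + hilbert N i)%N.
Proof.
move=> finM finN; apply: (kdimE (gm_deg_kspace grsum i)).
have [d0 /has_kdim_kdim] := fingen_has_kdim i finM; rewrite -/(hilbert M i).
have [d1 /has_kdim_kdim] := fingen_has_kdim i finN; rewrite -/(hilbert N i).
move: (hilbert M i) (hilbert N i) => d d'.
move=> /(has_kdimP _ (gm_deg_kspace N i))[b' [Ab' bs' bf']].
move=> /(has_kdimP _ (gm_deg_kspace M i))[b [Ab bs bf]].
apply/(has_kdimP _ (gm_deg_kspace grsum i)).
pose bb (j : 'I_(d + d')) : grsum :=
  match fintype.split j with inl k => (b k, 0) | inr k => (0, b' k) end.
have klinE (c : 'rV[K]_(d + d')) : klin bb c =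
  (klin b (lsubmx c), klin b' (rsubmx c)).
  rewrite /klin big_split_ord /= [LHS]surjective_pairing; congr (_, _).
    rewrite /= !(raddf_sum fst) /= [X in _ + X]big1 ?addr0 => [|j _].
      apply: eq_bigr => j _; rewrite /bb mxE.
      by rewrite (unsplitK (inl j)).
    by rewrite /bb (unsplitK (inr j)) /=; exact: scaler0.
  rewrite /= !(raddf_sum snd) /= [X in X + _]big1 ?add0r => [|j _].
    apply: eq_bigr => j _; rewrite /bb mxE.
    by rewrite (unsplitK (inr j)).
  by rewrite /bb (unsplitK (inl j)) /=; exact: scaler0.
exists bb; split=> [j|[u v] [/= /bs[c ->] /bs'[c' ->]]|c].
- by rewrite /bb; case: (fintype.split j) => k; split=> /=;
  by [apply: gm_deg0 | apply: Ab | apply: Ab'].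
- by exists (row_mx c c'); rewrite klinE row_mxKl row_mxKr.
rewrite klinE => -[/bf c0 /bf' c1]; by rewrite -[c]hsubmxK c0 c1 row_mx0.
Qed.

End DirectSum.

(** * Sums of shifted polynomial rings *)

Section RegularSeq.
Variable R : comNzRingType.

Lemma regular_seqP (V : lmodType R) (a : seq R) : regular_seq V a <->
  (forall i, (i < size a)%N -> forall v : V,
     a`_i *: v \in idealmul (take i a) V -> v \in idealmul (take i a) V) /\
  (exists v : V, v \notin idealmul a V).
Proof.
split=> -[reg [u nzu]]; (split; first by move=> i /reg/regular_quotm_injP).
  exists (repr u); apply: contraNN nzu => /quotm_pi_eq0.
  by rewrite quotm_piK => ->.
by exists (quotm_pi u); apply: contraNN nzu => /eqP/quotm_pi_eq0.
Qed.

Lemma idealmul_pair (V V' : lmodType R) (a : seq R) (u : (V * V')%type) :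
  (u \in idealmul a (V * V')%type) =
  (u.1 \in idealmul a V) && (u.2 \in idealmul a V').
Proof.
apply/idealmulP/andP => [[w ->]|[/idealmulP[w wE] /idealmulP[w' w'E]]].
  by split; apply/idealmulP; [exists (fun i => (w i).1)|exists (fun i => (w
    i).2)];
    rewrite ?(raddf_sum fst) ?(raddf_sum snd).
exists (fun i => (w i, w' i)); rewrite [LHS]surjective_pairing wE w'E.
rewrite [RHS]surjective_pairing; congr (_, _).
  by rewrite (raddf_sum fst).
by rewrite (raddf_sum snd).
Qed.

Lemma regular_seq_pair (V V' : lmodType R) (a : seq R) :
  regular_seq V a -> regular_seq V' a -> regular_seq (V * V')%type a.
Proof.
move=> /regular_seqP[reg [v va]] /regular_seqP[reg' _]; apply/regular_seqP;
  split.
  move=> i lti u; rewrite !idealmul_pair => /andP[/(reg _ lti)-> ].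
  exact: reg'.
by exists (v, 0); rewrite idealmul_pair negb_and va.
Qed.

(** Regularity on a quotient of the polynomial ring thereby becomes a question
    about ideals. *)
Lemma idealmul_quot (V : lmodType R) (a s : seq R) (p : V) :
  quotm_pi p \in idealmul s (quotm a V) <-> p \in idealmul (a ++ s) V.
Proof.
elim/last_ind: s p => [|s x IH] p.
  rewrite idealmul_nil cats0; split=> [/eqP/quotm_pi_eq0 //|/quotm_pi_eq0->].
  exact: eqxx.
rewrite -rcons_cat; split=> /idealmul_rcons[w pw]; apply/idealmul_rcons.
  exists (repr w); apply/IH; rewrite quotm_piB quotm_piZ quotm_piK //.
by exists (quotm_pi w); rewrite -quotm_piZ -quotm_piB; apply/IH.
Qed.

End RegularSeq.

Section Block.
Variables (K : fieldType) (n : nat).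
Local Notation S := {mpoly K[n.+1]}.

Definition tail_vars (e : nat) : seq 'X_{1..n.+1} :=
  [seq U_(i)%MM | i : 'I_n.+1 <- enum 'I_n.+1 & (e <= i)%N].
Definition initial_vars (r : nat) : seq 'X_{1..n.+1} :=
  [seq U_(inord i)%MM | i <- iota 0 r].

Lemma in_mono_tail_vars e m :
  in_mono (tail_vars e) m = ~~ [forall i : 'I_n.+1,
    (e <= i)%N ==> (m i == 0%N)].
Proof.
rewrite negb_forall; apply/hasP/existsP => [[_ /mapP[i ie ->]]|[i]].
  by rewrite lep1mP => mi; exists i; move: ie;
    rewrite mem_filter negb_imply mi => /andP[->].
rewrite negb_imply => /andP[ei mi]; exists U_(i)%MM; last by rewrite lep1mP.
by apply: map_f; rewrite mem_filter ei mem_enum.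
Qed.

Lemma tail_vars_homog e : {in [seq 'X_[m] : S | m <- tail_vars e],
  forall p, p \is homog mdeg}.
Proof.
move=> _ /mapP[_ /mapP[i _ ->] ->]; apply: (@homogE _ _ _ 1%N).
by rewrite dhomogX /= mdeg1.
Qed.

(** The polynomial ring in the first [e] variables, as a module over the whole
    polynomial ring. *)
Definition block (e : nat) : grmod K n.+1 := grquot (@tail_vars_homog e).

Lemma fingen_grquot (a : seq S) (a_homog : {in a, forall p, p \is homog mdeg}) :
  fingen (grquot a_homog).
Proof.
apply/fingenP; exists unit, (fun=> quotm_pi (1 : S^o)) => v.
exists (fun=> repr v); rewrite big_const card_unit /= addr0.
by rewrite -{1}(quotm_piK v) -quotm_piZ [_ *: _]mulr1.
Qed.

Lemma hilbert_grquot_neg (a : seq S) (a_homog : {in a, forall p,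
  p \is homog mdeg}) k :
  hilbert (grquot a_homog) (Negz k) = 0%N.
Proof.
apply: (kdimE (gm_deg_kspace _ _)); apply/(has_kdimP _ (gm_deg_kspace _ _)).
exists (fun=> 0); split=> [i|v [p /= -> ->]|c _]; first exact: gm_deg0.
  by exists 0; rewrite klin0 quotm_pi0.
by apply/rowP; case.
Qed.

Definition hilb_int (f : nat -> nat) (i : int) : nat :=
  if i is Posz k then f k else 0%N.

Lemma hilbert_block e i : (e <= n.+1)%N ->
  hilbert (block e) i = hilb_int (multichoose e) i.
Proof.
move=> le_en; case: i => [d|k]; last exact: hilbert_grquot_neg.
rewrite /= -(size_monomials n e d); apply: (kdimE (gm_deg_kspace _ _)).
apply: (@has_kdim_mono _ _ _ _ (tail_vars e)) => // [|m];
  first exact: uniq_monomials.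
by rewrite mem_monomials // in_mono_tail_vars negbK.
Qed.

(** Modulo some of the variables, any other variable is a nonzerodivisor. *)
Lemma regular_seq_block e r : (r <= e <= n.+1)%N ->
  regular_seq (block e) [seq 'X_[m] | m <- initial_vars r].
Proof.
case/andP=> le_re le_en; apply/regular_seqP; split; last first.
  exists (quotm_pi (1 : S^o)); apply/negP => /idealmul_quot.
  rewrite -map_cat => /idealmul_monoP/(_ 0%MM).
  rewrite msupp1 inE eqxx => /(_ isT)/hasP[g].
  by rewrite mem_cat => /orP[] /mapP[i _ ->]; rewrite lep1mP mnm0E.
rewrite !size_map size_iota => i ltir v; rewrite -(quotm_piK v) -quotm_piZ.
move: (repr v) => p /idealmul_quot;
  rewrite -map_take -map_cat => /idealmul_monoP H.
apply/idealmul_quot; rewrite -map_take -map_cat; apply/idealmul_monoP => m mp.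
have lti_n : (i < n.+1)%N by lia.
have /hasP[g gms le_gm] : in_mono (tail_vars e ++ take i (initial_vars r)) (m
  + U_(inord i))%MM.
  apply: H; rewrite (nth_map 0%MM) ?size_map ?size_iota // [_ *: _]mulrC.
  rewrite (nth_map 0%N) ?size_iota // nth_iota // add0n.
  by rewrite (perm_mem (msuppMX _ _)) addmC map_f.
have [k gk nek] : exists2 k : 'I_n.+1, g = U_(k)%MM & k != inord i.
  move: gms; rewrite mem_cat => /orP[/mapP[k ke ->]|].
    exists k => //; apply: contraTneq ke => ->.
    by rewrite mem_filter inordK // leqNgt (leq_trans ltir).
  rewrite -map_take take_iota => /mapP[k];
    rewrite mem_iota add0n leq0n /= => ltk ->.
  have ltki : (k < i)%N by move: ltk; rewrite leq_min; case/andP.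
  exists (inord k) => //; apply/eqP => /(congr1 (@nat_of_ord _)).
  by rewrite !inordK // ?(ltn_trans ltki) // => e_ki; rewrite e_ki ltnn in ltki.
apply/hasP; exists g; first by rewrite map_take.
move: le_gm; rewrite gk !lep1mP mnmDE mnm1E.
by rewrite (eq_sym _ k) (negPf nek) addn0.
Qed.

Lemma block_sum_module (l : seq (nat * nat)) r : l != [::] ->
  (forall p, p \in l -> (r <= p.1 <= n.+1)%N) ->
  exists N : grmod K n.+1, [/\ fingen N,
    forall i, hilbert N i = hilb_int (fun k => \sum_(p <- l) shifted_hilb p
      k)%N i
    & regular_seq N [seq 'X_[m] | m <- initial_vars r]].
Proof.
have one (p : nat * nat) : (r <= p.1 <= n.+1)%N ->
  exists N : grmod K n.+1, [/\ fingen N,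
    forall i, hilbert N i = hilb_int (shifted_hilb p) i
    & regular_seq N [seq 'X_[m] | m <- initial_vars r]].
  move=> pP; exists (grshift (block p.1) p.2); split.
  - exact: fingen_grquot.
  - move=> i; rewrite hilbert_grshift hilbert_block; last by case/andP: pP.
    rewrite /hilb_int /shifted_hilb; case: i => [k|k] /=; last first.
      by case ed: (_ - _) => [d|d] //; exfalso; lia.
    case: leqP => [lepk|ltkp]; first by rewrite subzn.
    by case ed: (_ - _) => [d|d] //; exfalso; lia.
  - exact: regular_seq_block.
elim: l => // p [_ _|q l IH _] lP.
  have [|N [? H ?]] := one p; first by apply: lP; rewrite mem_head.
  exists N; split=> // i; rewrite H; case: i => //= k; by rewrite big_seq1.
have [|N [finN HN rN]] := one p; first by apply: lP; rewrite mem_head.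
have [//||N' [finN' HN' rN']] := IH.
  by move=> x xl; apply: lP; rewrite inE xl orbT.
exists (grsum N N'); split; first exact: fingen_grsum.
  move=> i; rewrite hilbert_grsum // HN HN'; case: i => //= k.
  by rewrite [in RHS]big_cons.
exact: regular_seq_pair.
Qed.

End Block.

(** * Hilbert depth of the star *)

Lemma natmax_le (A : set nat) u : (forall d, A d -> (d <= u)%N) ->
  (natmax A <= u)%N.
Proof. by move=> Au; rewrite /natmax; case: xgetP => [d -> [/Au]|]. Qed.

Lemma natmax_ge (A : set nat) u d :
  (forall e, A e -> (e <= u)%N) -> A d -> (d <= natmax A)%N.
Proof.
move=> Au Ad; rewrite /natmax; case: xgetP => [e _ [_ /(_ d Ad)] //|nomax].
have exA : exists e, `[< A e >] by exists d; apply/asboolP.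
have leA e : `[< A e >] -> (e <= u)%N by move/asboolP/Au.
have [e /asboolP Ae maxe] := ex_maxnP exA leA.
by case: (nomax e); split=> // e' Ae'; apply/maxe/asboolP.
Qed.

Lemma idealmul_catl (R : comNzRingType) (V : lmodType R) (a s : seq R) (v : V) :
  v \in idealmul a V -> v \in idealmul (a ++ s) V.
Proof.
move=> va; elim/last_ind: s => [|s x IH]; first by rewrite cats0.
by rewrite -rcons_cat; apply/idealmul_rcons; exists 0; rewrite scaler0 subr0.
Qed.

Lemma regular_seq_take (R : comNzRingType) (V : lmodType R) (a : seq R) m :
  regular_seq V a -> regular_seq V (take m a).
Proof.
move=> /regular_seqP[reg [v va]]; apply/regular_seqP; split=> [i lti|].
  have ltim : (i < m)%N by move: lti; rewrite size_take; case: ifP => [//|];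
    lia.
  rewrite nth_take // take_takel; last exact: ltnW.
  by apply: reg; move: lti; rewrite size_take; case: ifP => [lt1 lt2|//]; lia.
exists v; apply: contraNN va => vm; rewrite -(cat_take_drop m a).
exact: idealmul_catl.
Qed.

Section Star.
Variables (K : fieldType) (n : nat).

Lemma hilbert_star i : hilbert (star_quot K n) i = hilb_int (star_hilb n) i.
Proof.
case: i => [d|k]; last exact: hilbert_grquot_neg.
pose y_pow : seq 'X_{1..n.+1} := if (0 < d)%N then [:: (U_(ord_max) *+ d)%MM]
  else [::].
pose ms : seq 'X_{1..n.+1} := [seq (U_(lift ord_max i)
  + U_(ord_max))%MM | i : 'I_n].
have star_hilbE : star_hilb n d = size (monomials n n d ++ y_pow).
  by rewrite size_cat size_monomials /star_hilb /y_pow; case: (0 < d)%N.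
have mem_mono m : (m \in monomials n n d) = (mdeg m == d) && (m ord_max == 0%N).
  rewrite mem_monomials ?leqnSn //; congr (_ && _).
  apply/forallP/idP => [/(_ ord_max)/implyP/(_ (leqnn n)) //|m0 i].
  apply/implyP => le_ni; suff -> : i = ord_max by [].
  by apply: val_inj; apply/eqP; rewrite eqn_leq le_ni -ltnS ltn_ord.
have mdeg_split (m : 'X_{1..n.+1}) : mdeg m =
  (\sum_(i < n) m (lift ord_max i) + m ord_max)%N.
  by rewrite mdegE (bigD1_ord ord_max) //= addnC.
rewrite /= star_hilbE; apply: (kdimE (gm_deg_kspace _ _)).
apply: (@has_kdim_mono _ _ _ _ ms).
- rewrite /star_gens /ms -map_comp; apply: eq_map => i /=; by rewrite mpolyXD.
- rewrite cat_uniq uniq_monomials ?leqnSn // /y_pow; case: ltnP => //= d_gt0.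
  by rewrite orbF andbT mem_mono mulmnE mnm1E eqxx mul1n eqn0Ngt d_gt0 andbF.
move=> m; rewrite mem_cat mem_mono.
have -> : in_mono ms m = (m ord_max != 0%N) && [exists i : 'I_n,
  m (lift ord_max i) != 0%N].
  apply/hasP/andP => [[_ /mapP[i _ ->] /mnm_lepP le_m]|[my /existsP[i mi]]].
    split; last (apply/existsP; exists i); rewrite -lt0n.
      by apply: leq_trans (le_m ord_max); rewrite mnmDE !mnm1E eqxx addn1.
    by apply: leq_trans (le_m (lift ord_max i)); rewrite mnmDE !mnm1E eqxx.
  exists (U_(lift ord_max i) + U_(ord_max))%MM; first by apply: map_f;
    rewrite mem_enum.
  apply/mnm_lepP => j; rewrite mnmDE !mnm1E.
  have [<-|nei] := eqVneq (lift ord_max i) j.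
    by rewrite (negPf (neq_lift _ _)) addn0 lt0n.
  by case: eqVneq => // <-; rewrite lt0n.
rewrite negb_and negbK; have [my|my] /= := eqVneq (m ord_max) 0%N.
  rewrite !andbT; case: eqVneq => //= md; rewrite /y_pow;
    case: ltnP => // d_gt0.
  rewrite inE; apply: contra_eqF md => /eqP mE; move: my.
  by rewrite mE mulmnE mnm1E eqxx mul1n => d0; rewrite d0 in d_gt0.
rewrite andbF /= negb_exists /y_pow; case: ltnP => [d_gt0|]; last first.
  rewrite leqn0 => /eqP->; rewrite mdeg_eq0; case: eqVneq => // m0.
  by rewrite m0 mnm0E in my.
rewrite inE; apply/eqP/andP => [->|[/eqP md /forallP m0]].
  rewrite mdegMn mdeg1 mul1n; split=> //; apply/forallP => i.
  by rewrite negbK mulmnE mnm1E (negPf (neq_lift _ _)).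
have {}m0 i : m (lift ord_max i) = 0%N by apply/eqP; have := m0 i;
  rewrite negbK.
apply/mnmP => j; rewrite mulmnE mnm1E; case: (unliftP ord_max j) => [i|] ->.
  by rewrite m0 (negPf (neq_lift _ _)).
rewrite eqxx mul1n; have := mdeg_split m; rewrite md big1 ?add0n //.
Qed.

Lemma initial_vars_max r :
  {subset [seq 'X_[m] | m <- initial_vars n r] <= @maxideal K n.+1}.
Proof.
move=> _ /mapP[_ /mapP[i _ ->] ->]; rewrite /maxideal.
have -> : [seq 'X_i0 | i0 : 'I_n.+1] =
  [seq 'X_[m] : {mpoly K[n.+1]} | m <- [seq U_(i0)%MM | i0 : 'I_n.+1]].
  by rewrite -map_comp.
apply/idealmul_monoP => m; rewrite msuppX inE => /eqP->.
by apply/hasP; exists U_(inord i)%MM; [apply: map_f;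
  rewrite mem_enum | exact: lepm_refl].
Qed.

(** A longer regular sequence could be cut to length [n - s], where the iterated
    difference of the Hilbert function takes a negative value. *)
Lemma star_regular_seq_size s k (N : grmod K n.+1) a :
  odd k -> (k.+1 < n - s.*2)%N -> (s * s.+1 < (n - s.*2 - k.+1) * (k * k.+1))%N
    ->
  fingen N -> hilbert N =1 hilbert (star_quot K n) ->
  {subset a <= @maxideal K n.+1} -> regular_seq N a -> (size a <= n - s.+1)%N.
Proof.
move=> oddk ltk big finN HN a_max reg_a; rewrite leqNgt; apply/negP => lt_a.
have le_a : (n - s <= size a)%N by lia.
have := star_hilb_not_ge0 oddk ltk big; rewrite ltNge => /negP; apply.
have -> : (fun k => (star_hilb n k)%:Z) = (fun k : nat => (hilbert N k)%:Z).
  by apply/funext => j; rewrite HN hilbert_star.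
rewrite -[X in iter X](size_takel le_a).
apply: regular_seq_diff_ge0 => //.
- by move=> i i_lt0; rewrite HN hilbert_star; case: i i_lt0.
- by move=> p /mem_take/a_max.
- exact: regular_seq_take.
Qed.

Lemma hdepth_star_bounds s k :
  odd k -> (k.+1 < n - s.*2)%N -> (s * s.+1 < (n - s.*2 - k.+1) * (k * k.+1))%N
    ->
  (n./2 <= hdepth (star_quot K n) <= n - s.+1)%N.
Proof.
move=> oddk ltk big.
have seq_le (N : grmod K n.+1) : fingen N ->
  hilbert N =1 hilbert (star_quot K n) ->
    forall d, (exists a : seq {mpoly K[n.+1]},
    [/\ {subset a <= @maxideal K n.+1}, regular_seq N a & size a = d]) ->
      (d <= n - s.+1)%N.
  move=> finN HN d [a [a_max reg_a <-]].
  exact: star_regular_seq_size oddk ltk big finN HN a_max reg_a.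
have depth_le d : (exists N : grmod K n.+1,
    [/\ fingen N, hilbert N =1 hilbert (star_quot K n) & depth N = d]) ->
      (d <= n - s.+1)%N.
  by case=> N [finN HN <-]; apply/natmax_le/seq_le.
apply/andP; split; last exact: natmax_le.
have [||l [lP lE]] := @star_hilb_decomposition n n./2; [lia|lia|].
have l_neq0 : l != [::].
  by apply/eqP => l0; have := lE 0%N;
    rewrite l0 big_nil /star_hilb multichoose_n0.
have [|N [finN HN regN]] := @block_sum_module K n l n./2 l_neq0.
  by move=> p /lP/andP[-> /leqW].
have {}HN : hilbert N =1 hilbert (star_quot K n).
  move=> i; rewrite HN hilbert_star; case: i => //= j; exact: lE.
apply: (@leq_trans (depth N)); last first.
  by apply: (natmax_ge depth_le); exists N.
apply: (natmax_ge (seq_le N finN HN)).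
exists [seq 'X_[m] | m <- initial_vars n n./2]; split=> //.
  exact: initial_vars_max.
by rewrite !size_map size_iota.
Qed.

(** For [j = n %/ q], the choice [s = n./2 - 2 j] and [k = 2 j - 1] makes the two
    sides of the numerical condition of order n^2/4 and at least 4 j^3; the
    latter wins once [j] is at least 2 q^2. *)
Lemma hdepth_star_approx q : (4 <= q)%N -> (2 * q ^ 3 < n)%N ->
  (n./2 <= hdepth (star_quot K n) <= n./2 + 2 * (n %/ q))%N.
Proof.
move=> q4 ltqn; set j := (n %/ q)%N.
have n_lt : (n < q * j.+1)%N by rewrite mulnC ltn_ceil //; lia.
have jq : (j * q <= n)%N by apply: leq_trunc_div.
have j_ge : (2 * q ^ 2 <= j)%N.
  by rewrite leq_divRL; [move: ltqn; rewrite !expnS expn0; nia|lia].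
have := @hdepth_star_bounds (n./2 - 2 * j) (2 * j).-1.
have j4 : (4 * j <= n)%N by nia.
have j_gt0 : (0 < j)%N.
  by apply: leq_trans j_ge; rewrite muln_gt0 expn_gt0 (leq_trans _ q4).
have oddj : odd (2 * j).-1 by lia.
move/(_ oddj); set s := (n./2 - 2 * j)%N.
have n2s : (4 * j <= n - s.*2)%N by rewrite /s; lia.
have jE : ((2 * j).-1.+1 = 2 * j)%N by lia.
rewrite jE => H; have /andP[-> /=] : (n./2 <= hdepth (star_quot K n) <=
  n - s.+1)%N.
  apply: H; first by lia.
  have n_le : (n <= 2 * (q * j))%N by nia.
  have nn_le : (n * n <= 2 * j * (j * j))%N.
    apply: leq_trans (leq_mul n_le n_le) _.
    have -> : (2 * (q * j) * (2 * (q * j)) = 2 * (2 * q ^ 2) * (j * j))%N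
      by ring.
    by rewrite leq_mul2r leq_mul2l j_ge !orbT.
  have ss_le : (s * s.+1 <= n * n)%N by apply: leq_mul; rewrite /s; lia.
  have d_ge : (2 * j <= n - s.*2 - 2 * j)%N by lia.
  have k_ge : (j * (2 * j) <= (2 * j).-1 * (2 * j))%N by rewrite leq_mul2r; lia.
  apply: leq_ltn_trans (leq_trans ss_le nn_le) _.
  apply: leq_trans (leq_mul d_ge k_ge); nia.
rewrite /s; lia.
Qed.

End Star.

Theorem corollary2p7 (R : realType) (K : fieldType) :
  ((hdepth (star_quot K n))%:R / n%:R : R) @[n --> \oo] --> (2^-1 : R).
Proof.
apply/cvgrPdist_le => e e_gt0.
(* For n > 2 q^3 the quotient lies within 2 / q above and 1 / (2 n) below 1/2. *)
pose q := (maxn 4 (Num.truncn (3 / e)).+1).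
have q4 : (4 <= q)%N by apply: leq_maxl.
have q_gt0 : (0 : R) < q%:R by rewrite ltr0n; lia.
have qe : 3 / q%:R <= e.
  rewrite ler_pdivrMr // mulrC -ler_pdivrMr //.
  apply: le_trans (_ : (Num.truncn (3 / e)).+1%:R <= _);
    last by rewrite ler_nat leq_maxr.
  by apply: ltW; apply: truncnS_gt.
exists (2 * q ^ 3).+1 => // n /= ltn.
have n_gt0 : (0 : R) < n%:R by rewrite ltr0n; lia.
have /andP[lo up] := hdepth_star_approx K q4 ltn.
apply: le_trans qe; move: (hdepth _) lo up => d lo up.
have lo' : (n%:R - 1 : R) <= 2 * d%:R.
  rewrite lerBlDr -natrM natr1 ler_nat; lia.
have up' : (q%:R * (2 * d%:R) : R) <= q%:R * n%:R + 4 * n%:R.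
  rewrite -!natrM -natrD ler_nat.
  have := leq_trunc_div n q; nia.
have qn : (q%:R <= n%:R :> R) by rewrite ler_nat; rewrite !expnS expn0 in ltn;
  nia.
have nn0 : n%:R != 0 :> R by rewrite gt_eqF.
have qn0 : q%:R != 0 :> R by rewrite gt_eqF.
have x_le : d%:R / n%:R <= 2^-1 + 2 / q%:R :> R.
  rewrite ler_pdivrMr //.
  have -> : (2^-1 + 2 / q%:R) * n%:R =
    (q%:R * n%:R + 4 * n%:R) / (2 * q%:R) :> R by field.
  rewrite ler_pdivlMr ?mulr_gt0 //; lra.
have x_ge : 2^-1 - 2^-1 / n%:R <= d%:R / n%:R :> R.
  rewrite ler_pdivlMr //.
  have -> : (2^-1 - 2^-1 / n%:R) * n%:R = (n%:R - 1) / 2 :> R by field.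
  lra.
have nq : n%:R^-1 <= q%:R^-1 :> R by rewrite lef_pV2.
have q_inv : 0 < q%:R^-1 :> R by rewrite invr_gt0.
rewrite ler_distl; apply/andP; split; lra.
Qed.
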